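(* (i) For every constant $c>0$ there is a function $\varepsilon_c:\mathbb{N}\to\mathbb{R}$ with $\varepsilon_c(M)\to 0$ as $M\to\infty$ such that the following holds: for all $n$ and every Boolean function $f:\{0,1\}^n\to\{0,1\}$, if $f$ can be implemented by a circuit over the basis $\{\oplus,\wedge,1\}$ with multiplicative complexity $M$, where $M\ge c\,n$, then $f$ can be implemented by a circuit over the same basis of total complexity at most $$\left(\tfrac12+\varepsilon_c(M)\right)\frac{M(M+2n)}{\log_2 M}.$$ (ii) This bound is asymptotically optimal: there exist Boolean functions $f_n$ of $n$ variables ($n\to\infty$) whose multiplicative complexities $M_n$ (the minimum number of $\wedge$-gates in a circuit over $\{\oplus,\wedge,1\}$ computing $f_n$) satisfy $M_n=\Omega(n)$, and such that every circuit over $\{\oplus,\wedge,1\}$ computing $f_n$ has total complexity at least $\left(\tfrac12-o(1)\right)\frac{M_n(M_n+2n)}{\log_2 M_n}$.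
   Context: A circuit over the basis $\{\oplus,\wedge,1\}$ on input variables $x_1,\dots,x_n$ is a directed acyclic graph whose sources are the variables and the constant $1$, and whose other nodes (gates) each compute either the XOR ($\oplus$) or the conjunction ($\wedge$) of two previously computed functions; it implements a Boolean function if that function is computed at some node. The multiplicative complexity of a circuit is the number of its $\wedge$-gates; the total complexity of a circuit is the total number of its gates ($\oplus$- and $\wedge$-gates). *)

(* Defs.v *)
From mathcomp Require Import all_boot.
From Stdlib Require Import Reals.

Set Implicit Arguments.
Unset Strict Implicit.
Unset Printing Implicit Defensive.

Definition boolfun (n : nat) := {ffun 'I_n -> bool} -> bool.

(* Gates of a circuit over the basis {xor, and, 1}; the arguments are node
   indices.  Node numbering for a circuit on n variables:
     node 0          = the constant 1,
     node 1 .. n     = the variables x_1 .. x_n,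
     node n+1+k      = the k-th gate (k = 0, 1, ...). *)
Inductive gate : Type :=
| XorGate of nat & nat
| AndGate of nat & nat.

Definition circuit := seq gate.

Definition gate_args (g : gate) : nat * nat :=
  match g with XorGate i j => (i, j) | AndGate i j => (i, j) end.

Definition wf_circuit (n : nat) (C : circuit) : bool :=
  all (fun p : nat * gate =>
         ((gate_args p.2).1 < n.+1 + p.1) && ((gate_args p.2).2 < n.+1 + p.1))
      (zip (iota 0 (size C)) C).

Definition eval_gate (vs : seq bool) (g : gate) : bool :=
  match g with
  | XorGate i j => xorb (nth false vs i) (nth false vs j)
  | AndGate i j => nth false vs i && nth false vs j
  end.

Definition node_values (n : nat) (C : circuit) (x : {ffun 'I_n -> bool}) : seq bool :=
  foldl (fun vs g => rcons vs (eval_gate vs g))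
        (true :: [seq x i | i <- enum 'I_n]) C.

Definition implements (n : nat) (C : circuit) (f : boolfun n) : Prop :=
  wf_circuit n C /\
  exists2 v, v < n.+1 + size C &
    forall x : {ffun 'I_n -> bool}, nth false (node_values C x) v = f x.

Definition is_and (g : gate) : bool := if g is AndGate _ _ then true else false.
Definition circ_mult (C : circuit) : nat := count is_and C.

Definition circ_size (C : circuit) : nat := size C.

Definition mult_complexity (n : nat) (f : boolfun n) (M : nat) : Prop :=
  (exists C, implements C f /\ circ_mult C = M) /\
  (forall C, implements C f -> M <= circ_mult C).

Definition log2 (x : R) : R := (ln x / ln 2)%R.

(* Main.v *)
(* Upper bound.  A circuit with [M] conjunctions amounts to [2 M] linear forms
   [u_k], [v_k] over the constant 1, the variables and the previous products
   [g_j = u_j v_j]; the output is one more such form.  The forms are handled in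
   strips of [2 h] consecutive ones, [2 h ~ log2 M].  In a strip, the columns
   available so far are sorted into [2 ^ (2 h)] classes according to their
   coefficients, each class is summed, and each form is a sum of class sums.
   The factor 1/2 comes from cutting the columns into blocks of
   [M / (log2 M) ^ 2] consecutive ones and computing beforehand the sums of all
   pairs inside a block: pairing the columns of the same class and block halves
   the number of additions, up to one leftover per class and block.

   Lower bound.  Consider functions [sum_B s_B G_B] with selector variables
   [s_B], where [G_B] is a sum of [b] products of two linear forms in the
   variables and the products used in [G_0, ..., G_{B-1}] ([B < b],
   [b ~ sqrt n / 2]).  The earlier products depend on fewer than [2 b ^ 2]
   linear forms of the variables, hence are invariant under a large space of
   translations; normalizing the new forms on [2 b] of these translations, the
   derivatives of [G_B] along them are the new factors themselves, so that
   distinct parameters give distinct functions.  This produces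
   [2 ^ ((1 - o(1)) M (M + 2 n))] functions with [M = b ^ 2 + b]
   conjunctions, while at most [2 ^ ((1 + o(1)) L log2 L)] functions have a
   circuit of size [L]: relabelling the gates of a circuit without repeated
   values gives [L!] different descriptions of the same function.  Finally the
   upper bound shows that a function of the class needing large circuits also
   has multiplicative complexity at least [n / 64]. *)
Require Import Defs.
From Stdlib Require Import ZArith Reals Lra Classical ClassicalEpsilon.
From mathcomp Require Import all_boot all_algebra all_fingroup.
From mathcomp Require Import zify.

Set Implicit Arguments.
Unset Strict Implicit.
Unset Printing Implicit Defensive.

Import GRing.Theory.
Local Open Scope ring_scope.

(** * Circuits computing sets of functions *)

(** As finite functions into the field of two elements, these form a finite abelian group: XOR is
    addition, and sets of functions have cardinals. *)
Notation bf n := {ffun {ffun 'I_n -> bool} -> bool}.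

Definition fand (n : nat) (f g : bf n) : bf n := [ffun x => f x * g x].

Definition op (n : nat) (a : bool) (f g : bf n) : bf n :=
  if a then fand f g else f + g.

Definition base (n k : nat) : bf n :=
  [ffun x : {ffun 'I_n -> bool} => nth false (true :: [seq x i | i <- enum 'I_n]) k].

Definition node (n : nat) (C : circuit) (k : nat) : bf n :=
  [ffun x => nth false (node_values C x) k].

Lemma node_values_rcons n C g (x : {ffun 'I_n -> bool}) :
  node_values (rcons C g) x
  = rcons (node_values C x) (eval_gate (node_values C x) g).
Proof. by rewrite /node_values foldl_rcons. Qed.

Lemma size_node_values n C (x : {ffun 'I_n -> bool}) :
  size (node_values C x) = (n.+1 + size C)%N.
Proof.
elim/last_ind: C => [|C g IH]; first by rewrite /= size_map size_enum_ord addn0.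
by rewrite node_values_rcons !size_rcons IH addnS.
Qed.

Lemma wf_circuit_rcons n C g :
  wf_circuit n (rcons C g)
  = wf_circuit n C && (((gate_args g).1 < n.+1 + size C)
                       && ((gate_args g).2 < n.+1 + size C))%N.
Proof.
rewrite /wf_circuit size_rcons -[(size C).+1]addn1 iotaD cats1 zip_rcons ?size_iota //.
by rewrite all_rcons /= andbC.
Qed.

Lemma node_nil n k : node n [::] k = base n k.
Proof. by []. Qed.

Lemma node_rcons_lt n C g k :
  (k < n.+1 + size C)%N -> node n (rcons C g) k = node n C k.
Proof.
move=> lk; apply/ffunP=> x; rewrite !ffunE node_values_rcons nth_rcons.
by rewrite size_node_values lk.
Qed.

Lemma node_rcons_last n C g :
  node n (rcons C g) (n.+1 + size C)
  = op (is_and g) (node n C (gate_args g).1) (node n C (gate_args g).2).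
Proof.
apply/ffunP=> x; rewrite ffunE node_values_rcons nth_rcons size_node_values.
by rewrite ltnn eqxx; case: g => i j /=; rewrite !ffunE //; do 2 case: (nth _ _ _).
Qed.

Lemma implementsE n C (f : boolfun n) :
  implements C f <->
  wf_circuit n C /\ exists2 v, (v < n.+1 + size C)%N & node n C v = finfun f.
Proof.
split=> -[wfC [v lv Hv]]; split=> //; exists v => //.
  by apply/ffunP=> x; rewrite !ffunE.
by move=> x; move/ffunP: Hv => /(_ x); rewrite !ffunE.
Qed.

(* The weights [(1, 1)] measure the total complexity and [(0, 1)] the
   multiplicative one. *)
Definition cost (wx wa : nat) (C : circuit) : nat :=
  (\sum_(g <- C) (if is_and g then wa else wx))%N.

Lemma cost_rcons wx wa C g :
  cost wx wa (rcons C g) = (cost wx wa C + (if is_and g then wa else wx))%N.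
Proof. by rewrite /cost -cats1 big_cat big_seq1. Qed.

Lemma cost_size C : cost 1 1 C = circ_size C.
Proof.
elim/last_ind: C => [|C g IH]; first by rewrite /cost big_nil.
by rewrite cost_rcons IH /circ_size size_rcons if_same addn1.
Qed.

Lemma cost_mult C : cost 0 1 C = circ_mult C.
Proof.
elim/last_ind: C => [|C g IH]; first by rewrite /cost big_nil.
by rewrite cost_rcons IH /circ_mult -cats1 count_cat /= addn0; case: is_and.
Qed.

(** One circuit provides all of [S] at once, so that constructions enlarge a predicate of available
    functions without handling node numbers. *)
Definition computes (wx wa n s : nat) (S : bf n -> Prop) : Prop :=
  exists C, [/\ wf_circuit n C, (cost wx wa C <= s)%N &
    forall f, S f -> exists2 v, (v < n.+1 + size C)%N & node n C v = f].

Definition is_base n (f : bf n) : Prop := exists2 k, (k <= n)%N & f = base n k.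

Section Computes.
Variables (wx wa n : nat).
Implicit Types (S : bf n -> Prop) (f g : bf n).

Lemma computes_base : computes wx wa 0 (@is_base n).
Proof.
exists [::]; split=> //; first by rewrite /cost big_nil.
by move=> _ [k lk ->]; exists k; rewrite ?addn0 ?ltnS.
Qed.

Lemma computes_sub s s' S S' :
  (s <= s')%N -> (forall f, S' f -> S f) -> computes wx wa s S -> computes wx wa s' S'.
Proof.
move=> les subS [C [wfC cC HC]]; exists C; split=> //; first exact: leq_trans les.
by move=> f /subS/HC.
Qed.

Lemma computes_op a s S f g : computes wx wa s S -> S f -> S g ->
  computes wx wa (s + (if a then wa else wx)) (fun k => k = op a f g \/ S k).
Proof.
move=> [C [wfC cC HC]] /HC [i li Ei] /HC [j lj Ej].
pose gt := if a then AndGate i j else XorGate i j.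
have Ea : is_and gt = a by rewrite /gt; case: (a).
have E1 : gate_args gt = (i, j) by rewrite /gt; case: (a).
exists (rcons C gt); split.
- by rewrite wf_circuit_rcons wfC E1 li lj.
- by rewrite cost_rcons Ea leq_add2r.
move=> k [->|/HC [v lv Ev]].
  exists (n.+1 + size C)%N; first by rewrite size_rcons addnS.
  by rewrite node_rcons_last Ea E1 Ei Ej.
by exists v; rewrite ?size_rcons ?node_rcons_lt // addnS ltnW.
Qed.

Lemma computes_add s S f g : computes wx wa s S -> S f -> S g ->
  computes wx wa (s + wx) (fun k => k = f + g \/ S k).
Proof. exact: (@computes_op false). Qed.

Lemma computes_mul s S f g : computes wx wa s S -> S f -> S g ->
  computes wx wa (s + wa) (fun k => k = fand f g \/ S k).
Proof. exact: (@computes_op true). Qed.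

Lemma computes_sum s S f (l : seq (bf n)) : computes wx wa s S -> S f ->
    (forall g, g \in l -> S g) ->
  computes wx wa (s + size l * wx) (fun k => k = f + \sum_(g <- l) g \/ S k).
Proof.
move=> cS Sf; elim/last_ind: l => [|l g IH] Sl.
  by apply: computes_sub cS; [rewrite addn0|move=> k [->|//]; rewrite big_nil addr0].
have /IH{}IH : forall h, h \in l -> S h.
  by move=> h hl; apply: Sl; rewrite mem_rcons inE hl orbT.
have Sg : S g by apply: Sl; rewrite mem_rcons mem_head.
apply: computes_sub (computes_add IH (or_introl erefl) (or_intror Sg)).
  by rewrite size_rcons; lia.
move=> k [->|]; last by right; right.
by left; rewrite -cats1 big_cat big_seq1 addrA.
Qed.
End Computes.

(** * The strip construction *)

Section Span.
Variable n : nat.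
Implicit Types (e : nat -> bf n) (f g : bf n).

Definition lincomb e (N : nat) (c : nat -> bool) : bf n := \sum_(i < N | c i) e i.

Definition spanned e (N : nat) f : Prop := exists c, f = lincomb e N c.

Lemma lincombD e N c d :
  lincomb e N c + lincomb e N d = lincomb e N (fun i => c i (+) d i).
Proof.
rewrite /lincomb big_mkcond [X in _ + X]big_mkcond -big_split [RHS]big_mkcond /=.
apply: eq_bigr => i _; case: (c i); case: (d i); rewrite /= ?addr0 ?add0r //.
by apply/ffunP=> x; rewrite !ffunE; case: (e i x).
Qed.

Lemma span_add e N f g : spanned e N f -> spanned e N g -> spanned e N (f + g).
Proof. by move=> [c ->] [d ->]; rewrite lincombD; eexists. Qed.

Lemma span_mem e N i : (i < N)%N -> spanned e N (e i).
Proof.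
move=> li; exists (fun j => j == i).
by rewrite /lincomb (big_pred1 (Ordinal li)).
Qed.

Lemma span_ext e e' N N' f : (N <= N')%N -> (forall i, (i < N)%N -> e i = e' i) ->
  spanned e N f -> spanned e' N' f.
Proof.
move=> leN ee [c ->]; exists (fun i => c i && (i < N)%N); rewrite /lincomb.
rewrite (big_ord_widen_cond N' c e leN); apply: eq_bigr => i /andP [_ li].
exact: ee.
Qed.

(** Only conjunctions are recorded, XOR being absorbed in spans. The sequence is infinite to spare a
    length; it can be padded by the constant 1, which equals its own square. *)
Definition and_chain e : Prop :=
  (forall i, (i <= n)%N -> e i = base n i) /\
  (forall k, exists u v,
     [/\ spanned e (n.+1 + k) u, spanned e (n.+1 + k) v & e (n.+1 + k)%N = fand u v]).

Lemma base0_idem : base n 0 = fand (base n 0) (base n 0).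
Proof. by apply/ffunP=> x; rewrite !ffunE. Qed.

(** Induction on the last gate: an XOR-gate stays in the current span, an AND-gate contributes one
    new term of [e]. *)
Lemma circuit_and_chain C : wf_circuit n C ->
  exists2 e, and_chain e &
    forall v, (v < n.+1 + size C)%N -> spanned e (n.+1 + circ_mult C) (node n C v).
Proof.
elim/last_ind: C => [_|C g IH].
  pose e i := if (i <= n)%N then base n i else base n 0.
  exists e; last first.
    move=> v; rewrite /= !addn0 node_nil => lv.
    have -> : base n v = e v by rewrite /e -ltnS lv.
    exact: span_mem.
  split=> [i li|k]; first by rewrite /e li.
  exists (base n 0), (base n 0); rewrite -base0_idem.
  have e0 : spanned e (n.+1 + k) (base n 0) by apply: (@span_mem e _ 0%N).
  by split=> //; rewrite /e addSn ltnNge leq_addr.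
rewrite wf_circuit_rcons => /andP [/IH [e [eb ech] Hv]] /andP [l1 l2].
set N := (n.+1 + circ_mult C)%N in Hv.
pose w := op (is_and g) (node n C (gate_args g).1) (node n C (gate_args g).2).
have [u [v [su sv Ew]]] :
  exists u v, [/\ spanned e N u, spanned e N v & is_and g -> w = fand u v].
  exists (node n C (gate_args g).1), (node n C (gate_args g).2).
  by split; [exact: Hv|exact: Hv|rewrite /w => ->].
case ag: (is_and g); last first.
  have -> : circ_mult (rcons C g) = circ_mult C.
    by rewrite /circ_mult -cats1 count_cat /= ag !addn0.
  exists e => // k; rewrite size_rcons addnS ltnS leq_eqVlt => /orP [/eqP ->|lk].
    rewrite node_rcons_last ag; apply: span_add; exact: Hv.
  by rewrite node_rcons_lt //; exact: Hv.
have -> : circ_mult (rcons C g) = (circ_mult C).+1.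
  by rewrite /circ_mult -cats1 count_cat /= ag addn0 addn1.
(* The new product replaces the padding at index [N]; spans of the first [N] terms do not change. *)
pose e' i := if (i < N)%N then e i else if i == N then w else base n 0.
have ee i : (i < N)%N -> e i = e' i by rewrite /e' => ->.
have sub N' f : (N <= N')%N -> spanned e N f -> spanned e' N' f.
  by move=> lN; apply: span_ext.
exists e'.
  split=> [i li|k]; first by rewrite /e' (leq_trans (_ : i < n.+1)%N) ?leq_addr ?eb.
  have [lk|lk|->] := ltngtP k (circ_mult C).
  - have [u' [v' [su' sv' E]]] := ech k; exists u', v'.
    have lkN : (n.+1 + k < N)%N by rewrite ltn_add2l.
    split; last by rewrite -ee.
      by apply: span_ext su' => // i li; apply/ee/(ltn_trans li).
    by apply: span_ext sv' => // i li; apply/ee/(ltn_trans li).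
  - exists (base n 0), (base n 0); rewrite -base0_idem.
    have e0 : spanned e' (n.+1 + k) (base n 0).
      have -> : base n 0 = e' 0%N by rewrite -ee ?eb // /N addSn.
      exact: span_mem.
    split=> //; rewrite /e' ltn_add2l eqn_add2l.
    by rewrite (gtn_eqF lk) ltnNge (ltnW lk).
  - exists u, v; split; [exact: sub|exact: sub|].
    by rewrite /e' ltnn eqxx Ew.
move=> k; rewrite size_rcons addnS ltnS leq_eqVlt => /orP [/eqP ->|lk].
  rewrite node_rcons_last -/w; have -> : w = e' N by rewrite /e' ltnn eqxx.
  by apply: span_mem; rewrite addnS.
by rewrite node_rcons_lt //; apply: sub (Hv _ lk); rewrite addnS.
Qed.
End Span.

Lemma computes_sums wx wa n s (S : bf n -> Prop) (ll : seq (bf n * seq (bf n))) :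
    computes wx wa s S ->
    (forall p, p \in ll -> S p.1 /\ forall g, g \in p.2 -> S g) ->
  computes wx wa (s + (\sum_(p <- ll) size p.2) * wx)%N
    (fun k => S k \/ exists2 p, p \in ll & k = p.1 + \sum_(g <- p.2) g).
Proof.
move=> cS; elim/last_ind: ll => [|ll p IH] H.
  by apply: computes_sub cS; [rewrite big_nil addn0|move=> f [//|[]]].
have /IH{}IH : forall q, q \in ll -> S q.1 /\ forall g, g \in q.2 -> S g.
  by move=> q lq; apply: H; rewrite mem_rcons inE lq orbT.
have [Sp1 Sp2] : S p.1 /\ forall g, g \in p.2 -> S g.
  by apply: H; rewrite mem_rcons mem_head.
have := computes_sum IH (or_introl Sp1) (fun g gp => or_introl (Sp2 g gp)).
apply: computes_sub; first by rewrite -cats1 big_cat big_seq1 mulnDl addnA.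
move=> f [Sf|[q]]; first by right; left.
rewrite mem_rcons inE => /orP [/eqP -> ->|lq ->]; first by left.
by right; right; exists q.
Qed.

(** * Class sums of columns, and pairing inside blocks *)

Section Strips.
Variables (n m : nat) (e : nat -> bf n).
Hypothesis m_gt0 : (0 < m)%N.
Implicit Types (S : bf n -> Prop) (f : bf n).

(* Columns are grouped in blocks of [m] consecutive indices; the sum of two
   columns of the same block is computed once and for all. *)
Definition avail (N : nat) f : Prop :=
  [\/ f = 0, (exists2 i, (i < N)%N & f = e i) |
      exists i j, [/\ (i < j)%N, (j < N)%N, (i %/ m = j %/ m)%N & f = e i + e j]].

(** The new pairs join column [N] to the earlier columns of its block, which are the [N %% m < m]
    indices from [N - N %% m] on. *)
Lemma avail_pairs s S N : computes 1 1 s S ->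
    (forall f, avail N f -> S f) -> S (e N) ->
  computes 1 1 (s + m) (fun f => S f \/ avail N.+1 f).
Proof.
move=> cS subS SeN.
pose ll := [seq (e N, [:: e i]) | i <- iota (N - N %% m) (N %% m)].
have Hll p : p \in ll -> S p.1 /\ forall g, g \in p.2 -> S g.
  case/mapP=> i; rewrite mem_iota subnK ?leq_mod // => /andP [_ li] ->; split=> //= g.
  by rewrite inE => /eqP ->; apply: subS; apply: Or32; exists i.
apply: computes_sub (computes_sums cS Hll).
  rewrite leq_add2l muln1 big_map sum1_size size_iota.
  exact/ltnW/ltn_pmod.
move=> f [Sf|]; first by left.
case=> [->|[i]|[i [j [lij]]]].
- by left; apply: subS; apply: Or31.
- rewrite ltnS leq_eqVlt => /orP [/eqP -> ->|li ->]; first by left.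
  by left; apply: subS; apply: Or32; exists i.
rewrite ltnS leq_eqVlt => /orP [/eqP Ej|lj] Eij ->; last first.
  by left; apply: subS; apply: Or33; exists i, j.
right; exists (e N, [:: e i]); last by rewrite /= big_seq1 Ej addrC.
apply/mapP; exists i => //; rewrite mem_iota subnK ?leq_mod //.
rewrite -Ej lij andbT {1}(divn_eq j m) addnK -Eij.
by rewrite {2}(divn_eq i m) leq_addr.
Qed.

(** Columns are taken two at a time; the successor in the bound accounts for a possible unpaired
    one. *)
Lemma block_pairing N (t : seq nat) q : uniq t ->
    all (fun i => (i < N)%N && (i %/ m == q)%N) t ->
  exists l : seq (bf n), [/\ forall f, f \in l -> avail N f, \sum_(f <- l) f = \sum_(i <- t) e i
    & ((size l).*2 <= (size t).+1)%N].
Proof.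
have [k] := ubnP (size t); elim: k t => // k IH [|i [|j t]] //=.
- by move=> _ _ _; exists [::]; rewrite !big_nil.
- move=> _ _ /andP [/andP [li _] _]; exists [:: e i]; rewrite !big_seq1; split=> // f.
  by rewrite inE => /eqP ->; apply: Or32; exists i.
rewrite !ltnS => lt; rewrite inE negb_or => /and3P [/andP [neij _] _ ut].
case/and3P=> [/andP [li qi] /andP [lj qj] at'].
have [l [Hl El Sl]] := IH t (ltnW lt) ut at'.
exists (e i + e j :: l); split.
- move=> f; rewrite inE => /orP [/eqP ->|/Hl //]; apply: Or33.
  have Eq : (i %/ m = j %/ m)%N by rewrite (eqP qi) (eqP qj).
  move: neij; rewrite neq_ltn => /orP [lij|lji]; first by exists i, j.
  by exists j, i; rewrite addrC.
- by rewrite !big_cons El addrA.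
- by rewrite /= doubleS !ltnS.
Qed.

(** Induction on the number of blocks, with at most one leftover column in each. *)
Lemma column_sum N (t : seq nat) G : uniq t ->
    all (fun i => (i < N)%N && (i %/ m < G)%N) t ->
  exists l : seq (bf n), [/\ forall f, f \in l -> avail N f, \sum_(f <- l) f = \sum_(i <- t) e i
    & ((size l).*2 <= size t + G)%N].
Proof.
elim: G t => [|G IH] t ut at'.
  have -> : t = [::] by case: t at' {ut} => //= i t; rewrite ltn0 andbF.
  by exists [::]; rewrite !big_nil.
pose a i := (i %/ m == G)%N.
have [|l1 [H1 E1 S1]] := @block_pairing N (filter a t) G (filter_uniq _ ut).
  rewrite all_filter; apply: sub_all at' => i /andP [li _] /=.
  by apply/implyP=> ai; rewrite li; exact: ai.
have [|l2 [H2 E2 S2]] := IH (filter (predC a) t) (filter_uniq _ ut).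
  rewrite all_filter; apply: sub_all at' => i /= /andP [li lG].
  by apply/implyP=> ai; rewrite li /= ltn_neqAle -ltnS lG andbT; exact: ai.
exists (l1 ++ l2); split.
- by move=> f; rewrite mem_cat => /orP [/H1|/H2].
- by rewrite big_cat E1 E2 [RHS](bigID a) /= !big_filter.
- have := count_predC a t; rewrite size_cat doubleD -!size_filter.
  by move: S1 S2; rewrite /predC /=; lia.
Qed.

(** The halved term pays for the sums of all [2 ^ r] classes, leftovers included; then each of the
    [r] forms adds at most [2 ^ r] class sums. *)
Definition strip_cost (r N : nat) : nat :=
  ((N + 2 ^ r * (N %/ m).+1)./2 + r * 2 ^ r)%N.

Lemma computes_strip s S N r (c : 'I_r -> nat -> bool) : computes 1 1 s S ->
    (forall f, avail N f -> S f) ->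
  computes 1 1 (s + strip_cost r N)
    (fun f => S f \/ exists k, f = lincomb e N (c k)).
Proof.
move=> cS subS.
(* The class of a column is the vector of its coefficients in the [r] forms. *)
pose pat i : {ffun 'I_r -> bool} := [ffun k => c k i].
pose cols p := [seq i <- iota 0 N | pat i == p].
have /fin_all_exists [l Hl] p : exists l : seq (bf n), [/\ forall f, f \in l -> avail N f,
    \sum_(f <- l) f = \sum_(i <- cols p) e i
    & ((size l).*2 <= size (cols p) + (N %/ m).+1)%N].
  apply: column_sum; first by rewrite filter_uniq ?iota_uniq.
  rewrite all_filter; apply/allP => i; rewrite mem_iota add0n => /= li.
  by apply/implyP=> _; rewrite li ltnS leq_div2r // ltnW.
pose ll := [seq (0 : bf n, l p) | p <- enum {ffun 'I_r -> bool}].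
have Hll p : p \in ll -> S p.1 /\ forall g, g \in p.2 -> S g.
  case/mapP=> q _ -> /=; split; first by apply: subS; apply: Or31.
  by move=> g gl; apply: subS; have [Hq _ _] := Hl q; apply: Hq.
have cS1 := computes_sums cS Hll.
pose rowl (k : 'I_r) :=
  [seq \sum_(i <- cols p) e i | p : {ffun 'I_r -> bool} <- enum {ffun 'I_r -> bool} & p k].
pose ll2 := [seq (0 : bf n, rowl k) | k : 'I_r <- enum 'I_r].
pose S1 f := S f \/ exists2 p, p \in ll & f = p.1 + \sum_(g <- p.2) g.
have Hll2 p : p \in ll2 -> S1 p.1 /\ forall g, g \in p.2 -> S1 g.
  case/mapP=> k _ -> /=; split; first by left; apply: subS; apply: Or31.
  move=> g /mapP [q _ ->]; right; exists (0, l q).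
    by apply/mapP; exists q; rewrite ?mem_enum.
  by have [_ Eq _] := Hl q; rewrite add0r Eq.
apply: computes_sub (computes_sums cS1 Hll2).
  rewrite /strip_cost !muln1 -addnA leq_add2l leq_add //.
    rewrite big_map big_enum /= -(doubleK (\sum_p _)%N) half_leq //.
    rewrite -mul2n big_distrr /=.
    apply: (@leq_trans (\sum_(p : {ffun 'I_r -> bool}) (size (cols p) + (N %/ m).+1))%N).
      by apply: leq_sum => p _; have [_ _] := Hl p; rewrite -mul2n.
    rewrite big_split /= sum_nat_const card_ffun card_bool card_ord leq_add2r.
    rewrite (eq_bigr (fun p => \sum_(i <- iota 0 N | pat i == p) 1)%N); last first.
      by move=> p _; rewrite /cols size_filter sum1_count.
    (* Every column has exactly one pattern, so the class sizes add up to [N]. *)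
    rewrite (exchange_big_dep xpredT) //=.
    rewrite (eq_bigr (fun=> 1%N)); first by rewrite sum1_size size_iota.
    by move=> i _; rewrite (big_pred1 (pat i)) // => p; rewrite eq_sym.
  rewrite big_map big_enum /= -[X in (_ <= X * _)%N](card_ord r) -sum_nat_const.
  apply: leq_sum => k _; rewrite size_map size_filter.
  apply: leq_trans (count_size _ _) _.
  by rewrite -cardE card_ffun card_bool card_ord.
move=> f [Sf|[k ->]]; first by left; left.
right; exists (0, rowl k).
  by apply/mapP; exists k; rewrite ?mem_enum.
rewrite /= add0r big_map big_filter big_enum_cond /= /lincomb.
rewrite -(big_mkord (c k) e) /index_iota subn0.
(* A column occurs in form [k] exactly when its pattern is true at [k], so the form is a sum of
   whole classes. *)
rewrite (partition_big pat (fun p => p k)) /=; last by move=> i; rewrite ffunE.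
apply: eq_bigr => p pk; rewrite /cols big_filter; apply: eq_bigl => i.
by case: eqP => [Ep|_]; rewrite ?andbF //; move: pk; rewrite -Ep ffunE => ->.
Qed.
End Strips.

Lemma lincomb_cat n (e : nat -> bf n) N k c :
  lincomb e (N + k) c
  = lincomb e N c + \sum_(g <- [seq e i | i <- iota N k & c i]) g.
Proof.
rewrite /lincomb -!(big_mkord c e) /index_iota !subn0 iotaD add0n big_cat /=.
by rewrite big_map big_filter.
Qed.

(** * Assembling the strips into a circuit *)

Section Upper.
Variables (n m h : nat) (e : nat -> bf n).
Hypotheses (m_gt0 : (0 < m)%N) (ech : and_chain e).

(** The forms of a strip are prepared over the [N] columns that precede it; the at most [h] products
    of the strip itself are added one by one. *)
Lemma computes_lincomb s (S : bf n -> Prop) N k c : computes 1 1 s S ->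
    (forall f, avail m e (N + k) f -> S f) -> S (lincomb e N c) -> (k <= h)%N ->
  computes 1 1 (s + h) (fun f => f = lincomb e (N + k) c \/ S f).
Proof.
move=> cS subS SN lk.
have := @computes_sum 1 1 n s S _ [seq e i | i <- iota N k & c i] cS SN.
rewrite -lincomb_cat => H; apply: computes_sub (H _) => //.
  rewrite leq_add2l muln1 size_map size_filter.
  by apply: leq_trans (count_size _ _) _; rewrite size_iota.
move=> g /mapP [i]; rewrite mem_filter mem_iota => /and3P [_ _ li] ->.
by apply: subS; apply: Or32; exists i.
Qed.

(** For each product of the strip, [h] gates complete each of the two factors, one gate multiplies
    them, and [m] gates form the new pairs. *)
Lemma computes_next_strip s K : computes 1 1 s (avail m e (n.+1 + K)) ->
  computes 1 1 (s + strip_cost m (h + h) (n.+1 + K) + h * (h + h + 1 + m))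
    (avail m e (n.+1 + (K + h))).
Proof.
set N := (n.+1 + K)%N => cS.
have /fin_all_exists [cd Hcd] (k : 'I_h) : exists cd : (nat -> bool) * (nat -> bool),
    e (N + k)%N = fand (lincomb e (N + k) cd.1) (lincomb e (N + k) cd.2).
  have [_ /(_ (K + k)%N) [u [v [[c ->] [d ->] E]]]] := ech.
  by exists (c, d); rewrite -addnA E addnA.
(* The [2 h] rows of the strip: first the left factors, then the right ones. *)
pose c (r : 'I_(h + h)) := match split r with inl i => (cd i).1 | inr i => (cd i).2 end.
have cS1 := computes_strip m_gt0 c cS (fun f H => H).
set s1 := (s + _)%N in cS1 *.
suff H k : (k <= h)%N -> computes 1 1 (s1 + k * (h + h + 1 + m))
    (fun f => avail m e (N + k) f \/ exists r, f = lincomb e N (c r)).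
  by apply: computes_sub (H h (leqnn h)) => // f Hf; left; rewrite /N -addnA.
elim: k => [_|k IH lk]; first by rewrite mul0n !addn0.
have {}IH := IH (ltnW lk).
have C1 : lincomb e N (cd (Ordinal lk)).1 = lincomb e N (c (lshift h (Ordinal lk))).
  by rewrite /c (unsplitK (inl _)).
have C2 : lincomb e N (cd (Ordinal lk)).2 = lincomb e N (c (rshift h (Ordinal lk))).
  by rewrite /c (unsplitK (inr _)).
have c1 := @computes_lincomb _ _ N k (cd (Ordinal lk)).1 IH
  (fun f H => or_introl H) (or_intror (ex_intro _ _ C1)) (ltnW lk).
have c2 := @computes_lincomb _ _ N k (cd (Ordinal lk)).2 c1
  (fun f H => or_intror (or_introl H))
  (or_intror (or_intror (ex_intro _ _ C2))) (ltnW lk).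
have c3 := computes_mul c2 (or_intror (or_introl erefl)) (or_introl erefl).
have Ek := Hcd (Ordinal lk); rewrite /= in Ek; rewrite -Ek in c3.
have c4 := avail_pairs m_gt0 c3
  (fun f H => or_intror (or_intror (or_intror (or_introl H)))) (or_introl erefl).
apply: computes_sub c4; first by rewrite mulSn; lia.
move=> f [|]; first by rewrite addnS; right.
by move=> Hr; left; right; right; right; right.
Qed.

(** One gate produces zero as [1 + 1]; each base column then needs at most [m] gates for its
    pairs. *)
Lemma computes_avail_base : computes 1 1 (1 + n.+1 * m) (avail m e n.+1).
Proof.
have zero : base n 0 + base n 0 = 0.
  by apply/ffunP=> x; rewrite !ffunE.
have B0 : is_base (base n 0) by exists 0%N.
have c0 := computes_add (computes_base 1 1 n) B0 B0; rewrite zero add0n in c0.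
suff H k : (k <= n.+1)%N -> computes 1 1 (1 + k * m)
    (fun f => avail m e k f \/ (f = 0 \/ is_base f)).
  by apply: computes_sub (H _ (leqnn _)) => // f; left.
elim: k => [_|k IH lk].
  apply: computes_sub c0; first by rewrite addn0.
  by move=> f [[->|[]//|[i [j []]]//]|//]; left.
have c1 := avail_pairs m_gt0 (IH (ltnW lk)) (fun f H => or_introl H).
have [eb _] := ech.
have Be : is_base (e k) by exists k; rewrite ?eb.
apply: computes_sub (c1 (or_intror (or_intror Be))); first by rewrite mulSn; lia.
by move=> f [H|H]; [right|left; right].
Qed.

(** The last term pays for the output form, summed column by column. *)
Definition upper_cost (b : nat) : nat :=
  (1 + n.+1 * m
   + \sum_(B < b) (strip_cost m (h + h) (n.+1 + B * h) + h * (h + h + 1 + m))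
   + (n.+1 + b * h))%N.

Lemma computes_span b M f : (M <= b * h)%N -> spanned e (n.+1 + M) f ->
  computes 1 1 (upper_cost b) (eq f).
Proof.
move=> lM sf.
have H : computes 1 1 (1 + n.+1 * m
   + \sum_(B < b) (strip_cost m (h + h) (n.+1 + B * h) + h * (h + h + 1 + m)))%N
   (avail m e (n.+1 + b * h)).
  elim: (b) => [|B IH].
    by apply: computes_sub computes_avail_base; rewrite ?mul0n ?addn0 // big_ord0 addn0.
  have := computes_next_strip IH; rewrite -mulSnr.
  by apply: computes_sub => //; rewrite big_ord_recr /= !addnA.
have [c Ef] : spanned e (n.+1 + b * h) f by apply: span_ext sf; rewrite ?leq_add2l.
have := @computes_sum 1 1 n _ _ 0 [seq e i | i <- iota 0 (n.+1 + b * h) & c i] H (Or31 _ _ erefl).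
rewrite big_map big_filter add0r.
have -> : \sum_(i <- iota 0 (n.+1 + b * h) | c i) e i = f.
  by rewrite Ef /lincomb -(big_mkord c e) /index_iota subn0.
move=> H1; apply: computes_sub (H1 _).
- rewrite leq_add2l muln1 size_map size_filter.
  by apply: leq_trans (count_size _ _) _; rewrite size_iota.
- by move=> _ <-; left.
- move=> g /mapP [i]; rewrite mem_filter mem_iota => /and3P [_ _ li] ->.
  by apply: Or32; exists i.
Qed.
End Upper.

Lemma computes_implements n s (f : boolfun n) :
  computes 1 1 s (eq (finfun f)) -> exists C, implements C f /\ (circ_size C <= s)%N.
Proof.
move=> [C [wfC cC /(_ _ erefl) [v lv Ev]]]; exists C; rewrite -cost_size; split=> //.
by apply/implementsE; split=> //; exists v.
Qed.

Lemma upper_bound n (f : boolfun n) C m h b : (0 < m)%N -> implements C f ->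
    (circ_mult C <= b * h)%N ->
  exists C', implements C' f /\ (circ_size C' <= upper_cost n m h b)%N.
Proof.
move=> m_gt0 /implementsE [wfC [v lv Ev]] lM; apply: computes_implements.
have [e ech Hv] := circuit_and_chain wfC.
by apply: (computes_span m_gt0 ech lM); rewrite -Ev; apply: Hv.
Qed.

(** The factor 4 clears two halvings: the one in [strip_cost] and the one in the triangular sum of
    the [B * h]. The error term [X] does not depend on the strip. *)
Lemma upper_cost_le n m h b : (0 < m)%N ->
  (4 * upper_cost n m h b <=
   2 * (b * n.+1) + h * (b * b) +
   2 * (b * (2 ^ (h + h) * ((n.+1 + b * h) %/ m).+1 + 4 * h * 2 ^ (h + h)
             + h * (4 * h + 2 + 2 * m))
    + 2 * (n.+1 * m) + 2 * (n.+1 + b * h) + 2))%N.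
Proof.
move=> m_gt0; rewrite /upper_cost.
set X := (2 ^ (h + h) * _ + 4 * h * 2 ^ (h + h) + _)%N.
have H B : (B < b)%N ->
  (2 * (strip_cost m (h + h) (n.+1 + B * h) + h * (h + h + 1 + m)) <=
   n.+1 + B * h + X)%N.
  move=> lB; rewrite /strip_cost /X.
  have : ((n.+1 + B * h) %/ m <= (n.+1 + b * h) %/ m)%N.
    by rewrite leq_div2r // leq_add2l leq_mul2r (ltnW lB) orbT.
  set q := (_ %/ m)%N; set q' := (_ %/ m)%N => lq.
  have := leq_mul (leqnn (2 ^ (h + h))) (lq : (q.+1 <= q'.+1)%N).
  set t := (2 ^ (h + h) * q.+1)%N; set t' := (2 ^ (h + h) * q'.+1)%N => lt.
  have := odd_double_half (n.+1 + B * h + t).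
  by rewrite !mulnDr; lia.
have {H} : forall b', (b' <= b)%N ->
  (4 * \sum_(B < b') (strip_cost m (h + h) (n.+1 + B * h) + h * (h + h + 1 + m))
   <= 2 * (b' * n.+1) + h * (b' * b') + 2 * (b' * X))%N.
  elim=> [|B IH] lB; first by rewrite big_ord0.
  rewrite big_ord_recr /=; have := IH (ltnW lB); have := H B lB.
  set F := (strip_cost _ _ _ + _)%N; set Y := \big[_/_]_(_ < _) _.
  have -> : (h * (B.+1 * B.+1) = h * (B * B) + 2 * (B * h) + h)%N by lia.
  by rewrite !mulSn; lia.
by move/(_ b (leqnn b)); set Y := \big[_/_]_(_ < _) _; lia.
Qed.

(** * Counting functions with small circuits *)

Lemma leq_expn2r m n e : (m <= n -> m ^ e <= n ^ e)%N.
Proof. by case: e => // e; rewrite leq_exp2r. Qed.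

Section Chains.
Variable n : nat.
Implicit Types (hs : seq (bf n)) (f : bf n).

Definition bases : seq (bf n) := [seq base n i | i <- iota 0 n.+1].

Lemma size_bases : size bases = n.+1.
Proof. by rewrite size_map size_iota. Qed.

Definition chain hs : Prop := forall k, (k < size hs)%N -> exists a i j,
  [/\ (i < n.+1 + k)%N, (j < n.+1 + k)%N &
      nth 0 hs k = op a (nth 0 (bases ++ hs) i) (nth 0 (bases ++ hs) j)].

Lemma chain_rcons hs a i j : chain hs ->
    (i < n.+1 + size hs)%N -> (j < n.+1 + size hs)%N ->
  chain (rcons hs (op a (nth 0 (bases ++ hs) i) (nth 0 (bases ++ hs) j))).
Proof.
set w := op a _ _ => ch li lj.
have E i' : (i' < n.+1 + size hs)%N ->
    nth 0 (bases ++ rcons hs w) i' = nth 0 (bases ++ hs) i'.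
  by move=> li'; rewrite -rcons_cat nth_rcons size_cat size_bases li'.
move=> k; rewrite size_rcons ltnS leq_eqVlt => /orP [/eqP ->|lk].
  by exists a, i, j; rewrite nth_rcons ltnn eqxx !E.
have [a' [i' [j' [li' lj' E']]]] := ch k lk; exists a', i', j'; split=> //.
have lk' : (n.+1 + k < n.+1 + size hs)%N by rewrite ltn_add2l.
by rewrite nth_rcons lk !E // (ltn_trans _ lk').
Qed.

(** Gates whose value already occurs are dropped. Distinct values are what later tells the
    relabellings of a circuit apart. *)
Lemma circuit_chain C : wf_circuit n C ->
  exists hs, [/\ uniq hs, chain hs, (size hs <= size C)%N &
    forall v, (v < n.+1 + size C)%N -> node n C v \in bases ++ hs].
Proof.
elim/last_ind: C => [_|C g IH].
  exists [::]; split=> // v; rewrite addn0 cats0 node_nil => lv.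
  by apply: map_f; rewrite mem_iota.
rewrite wf_circuit_rcons => /andP [/IH [hs [uhs ch shs Hv]] /andP [l1 l2]].
have Hlast v hs' : (v < n.+1 + size (rcons C g))%N ->
    {subset hs <= hs'} -> node n (rcons C g) (n.+1 + size C) \in bases ++ hs' ->
  node n (rcons C g) v \in bases ++ hs'.
  rewrite size_rcons addnS ltnS leq_eqVlt => /orP [/eqP ->//|lv] sub _.
  rewrite node_rcons_lt //; move: (Hv v lv); rewrite !mem_cat.
  by case/orP=> [->//|/sub ->]; rewrite orbT.
have [i1] := nthP 0 (Hv _ l1); have [i2] := nthP 0 (Hv _ l2).
rewrite size_cat size_bases => li2 E2 li1 E1.
have [inw|ninw] := boolP (node n (rcons C g) (n.+1 + size C) \in bases ++ hs).
  exists hs; split=> //; first by rewrite size_rcons (leq_trans shs).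
  by move=> v lv; apply: Hlast.
exists (rcons hs (node n (rcons C g) (n.+1 + size C))); split.
- by rewrite rcons_uniq uhs andbT; move: ninw; rewrite mem_cat negb_or => /andP [].
- by rewrite node_rcons_last -E1 -E2; apply: chain_rcons.
- by rewrite !size_rcons ltnS.
move=> v lv; apply: Hlast => //; first by move=> x hx; rewrite mem_rcons inE hx orbT.
by rewrite mem_cat mem_rcons mem_head orbT.
Qed.
End Chains.

(** * Descriptions of circuits and their relabellings *)

Section Descriptions.
Variables n l : nat.

Definition label := ('I_n.+1 + 'I_l)%type.
Definition desc := {ffun 'I_l -> bool * label * label}.

Definition lval (V : 'I_l -> bf n) (u : label) : bf n :=
  match u with inl a => base n a | inr k => V k end.

Definition before (k : 'I_l) (u : label) : bool :=
  if u is inr k' then (k' < k)%N else true.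

Definition describes (D : desc) (h : 'I_l -> bf n) : Prop :=
  forall k, [/\ before k (D k).1.2, before k (D k).2 &
    h k = op (D k).1.1 (lval h (D k).1.2) (lval h (D k).2)].

Definition step (D : desc) (V : {ffun 'I_l -> bf n}) : {ffun 'I_l -> bf n} :=
  [ffun k => op (D k).1.1 (lval V (D k).1.2) (lval V (D k).2)].

(* A description need not be topologically ordered: its values are found by
   updating all the gates simultaneously [l] times. *)
Definition run (D : desc) := iter l (step D) [ffun=> 0].

(** The arguments of gate [j] come before it, so its value is final after [j + 1] rounds. *)
Lemma run_describes D h k : describes D h -> run D k = h k.
Proof.
move=> Dh; rewrite /run.
suff H t : forall j : 'I_l, (j < t)%N -> iter t (step D) [ffun=> 0] j = h j.
  by apply: H.
elim: t => // t IH j lj; rewrite iterS ffunE.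
have [b1 b2 ->] := Dh j; congr op.
  by case: (D j).1.2 b1 => //= k' lk'; apply: IH; apply: leq_trans lk' _.
by case: (D j).2 b2 => //= k' lk'; apply: IH; apply: leq_trans lk' _.
Qed.

Definition relabel (s : {perm 'I_l}) (u : label) : label :=
  match u with inl a => inl a | inr k => inr (s k) end.

Definition desc_perm (s : {perm 'I_l}) (D : desc) : desc :=
  [ffun k => let d := D ((s^-1)%g k) in (d.1.1, relabel s d.1.2, relabel s d.2)].

(** Simultaneous updating from a constant start commutes with any permutation of the gates. *)
Lemma run_perm s D k : run (desc_perm s D) (s k) = run D k.
Proof.
rewrite /run; elim: (X in iter X) k => [|t IH] k; first by rewrite !ffunE.
rewrite !iterS !ffunE permK /=; congr op.
  by case: (D k).1.2 => //= k'; rewrite IH.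
by case: (D k).2 => //= k'; rewrite IH.
Qed.

Definition described (f : bf n) (p : desc * label) : Prop :=
  exists h, [/\ injective h, describes p.1 h & lval h p.2 = f].

Lemma described_perm f p s : described f p ->
  lval (run (desc_perm s p.1)) (relabel s p.2) = f.
Proof.
case: p => D [a|k] [h [_ Dh <-]] //=.
by rewrite run_perm (run_describes _ Dh).
Qed.

(** The map from a function and a permutation to the permuted description with its output label is
    injective. The right-hand side counts all such pairs of a description and a label. *)
Lemma card_described (A : {set bf n}) :
    (forall f, f \in A -> exists p, described f p) ->
  (#|A| * l`! <= (2 * (n.+1 + l) * (n.+1 + l)) ^ l * (n.+1 + l))%N.
Proof.
move=> HA.
pose p0 : desc * label := ([ffun=> (false, inl ord0, inl ord0)], inl ord0).
have /fin_all_exists [P HP] f : exists p, f \in A -> described f p.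
  by case fA: (f \in A); [have [p Hp] := HA f fA; exists p|exists p0].
pose phi (fs : bf n * {perm 'I_l}) :=
  (desc_perm fs.2 (P fs.1).1, relabel fs.2 (P fs.1).2).
have phi_inj : {in setX A [set: {perm 'I_l}] &, injective phi}.
  move=> [f s] [g t] /setXP [/HP Hf _] /setXP [/HP Hg _] [/= E1 E2].
  have Efg : f = g by rewrite -(described_perm s Hf) E1 E2 (described_perm t Hg).
  subst g; congr pair; have [h [hinj Dh _]] := Hf.
  (* Running the common description at label [k] yields both sides; injectivity of [h] then
     identifies the permutations. *)
  have Ht k : h ((s^-1)%g k) = h ((t^-1)%g k).
    by rewrite -!(run_describes _ Dh) -[LHS](run_perm s) -[RHS](run_perm t) !permKV E1.
  by apply: invg_inj; apply/permP=> k; apply: hinj.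
rewrite -[l`!]card_Sn -cardsT -cardsX -(card_in_imset phi_inj).
apply: leq_trans (max_card _) _.
by rewrite card_prod card_ffun !card_prod !card_sum !card_ord card_bool.
Qed.
End Descriptions.

Lemma circuit_described n L (f : bf n) C : wf_circuit n C -> (size C <= L)%N ->
    (exists2 v, (v < n.+1 + size C)%N & node n C v = f) ->
  exists l : 'I_L.+1, exists p : desc n l * label n l, described f p.
Proof.
move=> wfC sC [v lv <-]; have [hs [uhs ch shs Hv]] := circuit_chain wfC.
have ll : (size hs < L.+1)%N by rewrite ltnS (leq_trans shs).
exists (Ordinal ll) => /=; set l := size hs in shs ll *.
(* Converts node indices to labels; the final default is not reached for [i < n.+1 + l]. *)
pose lab (i : nat) : label n l :=
  if (i < n.+1)%N then inl (inord i)
  else if insub (i - n.+1)%N is Some k then inr k else inl ord0.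
pose h (k : 'I_l) := nth 0 hs k.
have hlab i : (i < n.+1 + l)%N -> lval h (lab i) = nth 0 (bases n ++ hs) i.
  move=> li; rewrite /lab nth_cat size_bases; case: ifP => li'.
    by rewrite /= inordK // (nth_map 0%N) ?size_iota // nth_iota.
  have lk : (i - n.+1 < l)%N by rewrite ltn_subLR // leqNgt li'.
  by rewrite insubT /h.
have blab i (k : 'I_l) : (i < n.+1 + k)%N -> before k (lab i).
  rewrite /lab; case: ifP => // li' li.
  case: insubP => //= k' _ ->; rewrite ltn_subLR // leqNgt li' //.
have /fin_all_exists [D HD] (k : 'I_l) : exists d : bool * label n l * label n l,
   [/\ before k d.1.2, before k d.2 & h k = op d.1.1 (lval h d.1.2) (lval h d.2)].
  have [a [i [j [li lj E]]]] := ch k (ltn_ord k); exists (a, lab i, lab j).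
  have lk : (n.+1 + k < n.+1 + l)%N by rewrite ltn_add2l.
  by split; rewrite /= ?blab // !hlab // (ltn_trans _ lk).
have /nthP -/(_ 0) [i li Ei] := Hv v lv.
exists (finfun D, lab i), h; split.
- by move=> k k' /eqP; rewrite /h nth_uniq // => /eqP/val_inj.
- by move=> k; rewrite ffunE; apply: HD.
- by rewrite /= hlab //; move: li; rewrite size_cat size_bases.
Qed.

Lemma card_small_circuits n L (A : {set bf n}) :
    (forall f, f \in A -> exists C, [/\ wf_circuit n C, (size C <= L)%N &
       exists2 v, (v < n.+1 + size C)%N & node n C v = f]) ->
  (#|A| * L`! <= L.+1 * ((2 * (n.+1 + L) * (n.+1 + L)) ^ L * (n.+1 + L)))%N.
Proof.
move=> HA; set N := (n.+1 + L)%N.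
have /fin_all_exists [lev Hlev] f : exists l : 'I_L.+1, f \in A ->
    exists p : desc n l * label n l, described f p.
  case fA: (f \in A); last by exists ord0.
  by have [C [wfC sC Hv]] := HA f fA; have [l Hl] := circuit_described wfC sC Hv; exists l.
have Hl (l : 'I_L.+1) :
    (#|[set f in A | lev f == l]| * L`! <= (2 * N * N) ^ L * N)%N.
  have lL : (l <= L)%N by rewrite -ltnS.
  have /card_described H : forall f, f \in [set f in A | lev f == l] ->
      exists p : desc n l * label n l, described f p.
    by move=> f; rewrite inE => /andP [/Hlev H /eqP <-].
  (* Allows multiplying by the same factorial for every length [l]: the surplus [L ^ (L - l)] is
     absorbed when the exponent [l] is raised to [L]. *)
  have fL : (L`! <= l`! * L ^ (L - l))%N.
    rewrite -{1 3}(subnKC lL); elim: (L - l)%N => [|k IH]; first by rewrite addn0 muln1.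
    rewrite addnS factS (leq_trans (leq_mul (leqnn _) IH)) //.
    rewrite mulnCA leq_mul2l expnS.
    have : ((l + k) ^ k <= (l + k).+1 ^ k)%N by rewrite leq_expn2r.
    by move=> ?; rewrite leq_mul2l; lia.
  apply: leq_trans (leq_mul (leqnn _) fL) _; rewrite mulnA.
  apply: leq_trans (leq_mul H (leqnn _)) _.
  have lN : (n.+1 + l <= N)%N by rewrite leq_add2l.
  rewrite mulnAC leq_mul // -[in X in (_ <= X)%N](subnKC lL) expnD leq_mul //.
    by apply: leq_expn2r; rewrite !leq_mul.
  by apply: leq_expn2r; rewrite /N; nia.
rewrite -sum1_card (partition_big lev xpredT) //= big_distrl /=.
rewrite -[X in (_ <= X * _)%N](card_ord L.+1) -sum_nat_const; apply: leq_sum => l _.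
apply: leq_trans (Hl l); rewrite leq_mul2r -sum1_card; apply/orP; right.
by rewrite (eq_bigl (fun f => (f \in A) && (lev f == l))) // => f; rewrite inE.
Qed.

(** * A large class of functions with few conjunctions *)

Section DualFamilies.
Variable F : fieldType.

(** The left kernel of [P] has dimension at least [n - q], hence contains [d] independent rows; the
    columns of [R] are linear forms dual to them. *)
Lemma kernel_dual_family n q d (P : 'M[F]_(n, q)) : (q + d <= n)%N ->
  exists (V : 'M_(d, n)) (R : 'M_(n, d)), V *m P = 0 /\ V *m R = 1%:M.
Proof.
move=> le_n; pose B := row_base (kermx P).
have ld : (d <= \rank (kermx P))%N.
  rewrite mxrank_ker; apply: leq_trans (leq_sub2l n (rank_leq_col P)).
  by rewrite leq_subRL ?(leq_trans (leq_addr _ _) le_n).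
have /row_freeP [R BR] : row_free B by apply: row_base_free.
exists (pid_mx d *m B), (R *m pid_mx d); split.
  rewrite -mulmxA; suff -> : B *m P = 0 by rewrite mulmx0.
  by apply/sub_kermxP; rewrite eq_row_base.
rewrite mulmxA -(mulmxA _ B) BR mulmx1 mul_pid_mx minnn (minn_idPr ld).
by rewrite pid_mx_1.
Qed.

(** The columns of [K] form a basis of the linear forms vanishing on the rows of [V]; the left
    inverse [K'] makes the coordinates in this basis unique. *)
Lemma kernel_parametrization n d (V : 'M[F]_(d, n)) (R : 'M_(n, d)) :
    V *m R = 1%:M ->
  exists (K : 'M_(n, n - d)) (K' : 'M_(n - d, n)), V *m K = 0 /\ K' *m K = 1%:M.
Proof.
move=> VR.
have rV : \rank V = d by apply/eqP/row_freeP; exists R.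
pose B := row_base (kermx V^T).
have rk : \rank (kermx V^T) = (n - d)%N by rewrite mxrank_ker mxrank_tr rV.
have /row_freeP [Q BQ] : row_free B by apply: row_base_free.
have BV : B *m V^T = 0 by apply/sub_kermxP; rewrite eq_row_base.
(* The height of [B] is a rank; forgetting how [B] is defined lets this height be rewritten to
   [n - d]. *)
clearbody B; move: B Q BQ BV; rewrite rk => B Q BQ BV.
exists B^T, Q^T; rewrite -!trmx_mul BQ trmx1; split=> //.
by apply: trmx_inj; rewrite trmx_mul trmxK trmx0.
Qed.
End DualFamilies.

(** * Linear forms, translations and combinations of products *)

Section LinearForms.
Variable n : nat.
Implicit Types (v : 'rV[bool]_n) (lam : 'cV[bool]_n) (x : {ffun 'I_n -> bool}).

Definition lin lam : bf n := [ffun x : {ffun 'I_n -> bool} => \sum_i lam i 0 * x i].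

Definition shift x v : {ffun 'I_n -> bool} := [ffun i => x i + v 0 i].

(** Equivalently, [g] depends only on the values of the [q] linear forms given by the columns of
    [P]. *)
Definition shift_invariant q (P : 'M[bool]_(n, q)) (g : bf n) : Prop :=
  forall v, v *m P = 0 -> forall x, g (shift x v) = g x.

Definition combination k (gs : 'I_k -> bf n) lam (c : {ffun 'I_k -> bool}) : bf n :=
  lin lam + \sum_(i | c i) gs i.

(** Independence modulo linear forms: no nontrivial sum of the [gs] is linear. Hence a combination
    determines its coefficients. *)
Definition independent k (gs : 'I_k -> bf n) : Prop :=
  forall lam c, combination gs lam c = 0 -> lam = 0 /\ c = 0.

Lemma addbool_eq0 (a b : bool) : a + b = 0 -> a = b.
Proof. by case: a; case: b. Qed.

Lemma addff (f : bf n) : f + f = 0.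
Proof. by apply/ffunP=> x; rewrite !ffunE; case: (f x). Qed.

Lemma fandE (f g : bf n) x : fand f g x = f x * g x.
Proof. by rewrite ffunE. Qed.

Lemma faddE (f g : bf n) x : (f + g) x = f x + g x.
Proof. by rewrite ffunE. Qed.

Lemma f0E x : (0 : bf n) x = 0.
Proof. by rewrite ffunE. Qed.

Lemma linD lam mu : lin (lam + mu) = lin lam + lin mu.
Proof.
apply/ffunP=> x; rewrite !ffunE -big_split /=; apply: eq_bigr => i _.
by rewrite mxE mulrDl.
Qed.

Lemma lin_shift lam x v : lin lam (shift x v) = lin lam x + (v *m lam) 0 0.
Proof.
rewrite !ffunE mxE -big_split /=; apply: eq_bigr => i _.
by rewrite ffunE mulrDr [v 0 i * _]mulrC.
Qed.

Lemma lin_eq0 lam : lin lam = 0 -> lam = 0.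
Proof.
move=> E; apply/matrixP=> i j; rewrite ord1 mxE.
move/ffunP: E => /(_ [ffun i' => i' == i]); rewrite !ffunE (bigD1 i) //= ffunE eqxx.
rewrite mulr1 big1 ?addr0 // => i' ne; rewrite ffunE (negbTE ne).
by rewrite mulr0.
Qed.

Lemma combinationD k (gs : 'I_k -> bf n) lam mu c d :
  combination gs lam c + combination gs mu d = combination gs (lam + mu) (c + d).
Proof.
rewrite /combination linD addrACA; congr (_ + _).
rewrite big_mkcond [X in _ + X]big_mkcond -big_split [RHS]big_mkcond /=.
apply: eq_bigr => i _; rewrite ffunE.
by case: (c i); case: (d i); rewrite /= ?addr0 ?add0r ?addff.
Qed.

Lemma combination_inj k (gs : 'I_k -> bf n) lam mu c d : independent gs ->
  combination gs lam c = combination gs mu d -> lam = mu /\ c = d.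
Proof.
move=> ind E; have /ind [E1 E2] : combination gs (lam + mu) (c + d) = 0.
  by rewrite -combinationD E addff.
split.
  apply/matrixP=> i j; move/matrixP: E1 => /(_ i j); rewrite !mxE; exact: addbool_eq0.
apply/ffunP=> i; move/ffunP: E2 => /(_ i); rewrite !ffunE; exact: addbool_eq0.
Qed.

Lemma combination_shift k (gs : 'I_k -> bf n) q (P : 'M_(n, q)) lam c v x :
    (forall i, shift_invariant P (gs i)) -> v *m P = 0 ->
  combination gs lam c (shift x v) = combination gs lam c x + (v *m lam) 0 0.
Proof.
move=> inv vP; rewrite ![(combination _ _ _) _]ffunE lin_shift addrAC; congr (_ + _ + _).
by rewrite !sum_ffunE; apply: eq_bigr => i _; apply: inv vP _.
Qed.
End LinearForms.

(** * One era: a sum of [d] products recovered from its derivatives *)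

Section Era.
Variables (n k q d : nat) (gs : 'I_k -> bf n) (P : 'M[bool]_(n, q)).
Hypotheses (gs_inv : forall i, shift_invariant P (gs i)) (gs_ind : independent gs).
Variables (V : 'M[bool]_(d + d, n)) (R : 'M[bool]_(n, d + d)).
Variables (K : 'M[bool]_(n, n - (d + d))) (K' : 'M[bool]_(n - (d + d), n)).
Hypotheses (VP : V *m P = 0) (VR : V *m R = 1%:M) (VK : V *m K = 0)
  (KK : K' *m K = 1%:M).

Definition params :=
  {ffun 'I_d -> ('cV[bool]_(n - (d + d)) * {ffun 'I_k -> bool})
              * ('cV[bool]_(n - (d + d)) * {ffun 'I_k -> bool})}.

Implicit Types (p : params) (j : 'I_d).

(** The column of [R] prescribes the values on the rows of [V] as those of a dual basis; the
    parameter adds an arbitrary form vanishing on these rows. *)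
Definition lamL p j : 'cV[bool]_n := col (lshift d j) R + K *m (p j).1.1.
Definition lamR p j : 'cV[bool]_n := col (rshift d j) R + K *m (p j).2.1.
Definition factorL p j : bf n := combination gs (lamL p j) (p j).1.2.
Definition factorR p j : bf n := combination gs (lamR p j) (p j).2.2.
Definition gatef p j : bf n := fand (factorL p j) (factorR p j).
Definition era p : bf n := \sum_j gatef p j.

Lemma row_V_ker i : row i V *m P = 0.
Proof. by rewrite -row_mul VP row0. Qed.

Lemma row_V_form i u (w : 'cV_(n - (d + d))) :
  (row i V *m (col u R + K *m w)) 0 0 = (i == u).
Proof.
rewrite mulmxDr -row_mul mulmxA -row_mul VK row0 mul0mx addr0.
by rewrite colE mulmxA VR mul1mx !mxE andbT; case: eqP.
Qed.

Lemma factorL_shift p j i x :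
  factorL p j (shift x (row i V)) = factorL p j x + (i == lshift d j).
Proof. by rewrite (combination_shift _ _ _ gs_inv (row_V_ker i)) row_V_form. Qed.

Lemma factorR_shift p j i x :
  factorR p j (shift x (row i V)) = factorR p j x + (i == rshift d j).
Proof. by rewrite (combination_shift _ _ _ gs_inv (row_V_ker i)) row_V_form. Qed.

(** Along the left direction of product [i], the left factor of that product is the only factor to
    change, so the derivative is its right factor. *)
Lemma gatef_shiftL p i j x : gatef p j (shift x (row (lshift d i) V))
  = gatef p j x + (if i == j then factorR p j x else 0).
Proof.
rewrite !fandE factorL_shift factorR_shift eq_lrshift eq_lshift addr0 mulrDl.
by case: eqP => _; rewrite ?mul1r ?mul0r.
Qed.

Lemma gatef_shiftR p i j x : gatef p j (shift x (row (rshift d i) V))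
  = gatef p j x + (if i == j then factorL p j x else 0).
Proof.
rewrite !fandE factorL_shift factorR_shift eq_rlshift eq_rshift addr0 mulrDr.
by case: eqP => _; rewrite ?mulr1 ?mulr0.
Qed.

(** Stated for a subset [c] of the products, since it serves both the full sum [era] and the
    independence of the new products. *)
Lemma sum_shiftL p (c : pred 'I_d) i x :
  (\sum_(j | c j) gatef p j) (shift x (row (lshift d i) V))
  = (\sum_(j | c j) gatef p j) x + (if c i then factorR p i x else 0).
Proof.
rewrite !sum_ffunE (eq_bigr _ (fun j _ => gatef_shiftL p i j x)) big_split /=.
congr (_ + _); rewrite -big_mkcondr /=; case: ifP => ci.
  by rewrite (big_pred1 i) // => j; rewrite /= eq_sym; case: eqP => [->|_]; rewrite ?ci ?andbF.
by rewrite big1 // => j /andP [cj /eqP Ej]; rewrite Ej cj in ci.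
Qed.

Lemma sum_shiftR p (c : pred 'I_d) i x :
  (\sum_(j | c j) gatef p j) (shift x (row (rshift d i) V))
  = (\sum_(j | c j) gatef p j) x + (if c i then factorL p i x else 0).
Proof.
rewrite !sum_ffunE (eq_bigr _ (fun j _ => gatef_shiftR p i j x)) big_split /=.
congr (_ + _); rewrite -big_mkcondr /=; case: ifP => ci.
  by rewrite (big_pred1 i) // => j; rewrite /= eq_sym; case: eqP => [->|_]; rewrite ?ci ?andbF.
by rewrite big1 // => j /andP [cj /eqP Ej]; rewrite Ej cj in ci.
Qed.

Lemma form_inj u (w w' : 'cV_(n - (d + d))) :
  col u R + K *m w = col u R + K *m w' -> w = w'.
Proof. by move/addrI=> E; rewrite -[w]mul1mx -[w']mul1mx -KK -!mulmxA E. Qed.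

(* The derivatives of the sum along the dual directions are the factors. *)
Lemma era_inj : injective era.
Proof.
move=> p p' E.
have EL j : factorL p j = factorL p' j.
  apply/ffunP=> x; move/ffunP: (E) => /(_ (shift x (row (rshift d j) V))).
  by rewrite !sum_shiftR -/(era p) -/(era p') E => /addrI.
have ER j : factorR p j = factorR p' j.
  apply/ffunP=> x; move/ffunP: (E) => /(_ (shift x (row (lshift d j) V))).
  by rewrite !sum_shiftL -/(era p) -/(era p') E => /addrI.
apply/ffunP=> j.
have [/form_inj E1 E2] := combination_inj gs_ind (EL j).
have [/form_inj E3 E4] := combination_inj gs_ind (ER j).
by move: E1 E2 E3 E4; case: (p j) => [[? ?] [? ?]]; case: (p' j) => [[? ?] [? ?]] /= -> -> -> ->.
Qed.

Definition gs_next p (i : 'I_(k + d)) : bf n :=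
  match split i with inl i => gs i | inr j => gatef p j end.

(** Adds the linear parts of the [2 d] new factors, so that the remaining translations leave the new
    products invariant too. *)
Definition P_next p : 'M[bool]_(n, q + (d + d)) :=
  row_mx P (row_mx (\matrix_(i, j) lamL p j i 0) (\matrix_(i, j) lamR p j i 0)).

Lemma gs_next_inv p i : shift_invariant (P_next p) (gs_next p i).
Proof.
move=> v /eqP; rewrite /P_next !mul_mx_row !row_mx_eq0.
case/and3P=> [/eqP vP /eqP vL /eqP vR] x.
have HL j : (v *m lamL p j) 0 0 = 0.
  move/matrixP: vL => /(_ 0 j); rewrite [RHS]mxE => <-; rewrite ![(_ *m _) _ _]mxE.
  by apply: eq_bigr => i' _; rewrite [X in _ = _ * X]mxE.
have HR j : (v *m lamR p j) 0 0 = 0.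
  move/matrixP: vR => /(_ 0 j); rewrite [RHS]mxE => <-; rewrite ![(_ *m _) _ _]mxE.
  by apply: eq_bigr => i' _; rewrite [X in _ = _ * X]mxE.
rewrite /gs_next; case: split => j; first exact: gs_inv vP x.
by rewrite !fandE !(combination_shift _ _ _ gs_inv vP) HL HR !addr0.
Qed.

Lemma combination_next p lam c : combination (gs_next p) lam c
  = combination gs lam [ffun i => c (lshift d i)] + \sum_(j | c (rshift k j)) gatef p j.
Proof.
rewrite /combination -addrA; congr (_ + _).
rewrite big_mkcond big_split_ord /=; congr (_ + _).
  rewrite [RHS]big_mkcond; apply: eq_bigr => i _.
  by rewrite ffunE /gs_next (unsplitK (inl i)).
rewrite [RHS]big_mkcond; apply: eq_bigr => i _.
by rewrite /gs_next (unsplitK (inr i)).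
Qed.

(** If product [i] occurred in a vanishing combination, differentiation along its left direction
    would make its right factor constant, whereas that factor changes along its own right
    direction. *)
Lemma gs_next_ind p : independent (gs_next p).
Proof.
move=> lam c; rewrite combination_next => E.
have c0 i : c (rshift k i) = false.
  apply/negP=> ci.
  have H x : (row (lshift d i) V *m lam) 0 0 = factorR p i x.
    have := fun y => combination_shift lam [ffun i => c (lshift d i)] y gs_inv
      (row_V_ker (lshift d i)).
    move: E; set cb := combination _ _ _; move: cb => cb E Hcb.
    have E2 : (cb + \sum_(j | c (rshift k j)) gatef p j) x = 0 by rewrite E f0E.
    have : (cb + \sum_(j | c (rshift k j)) gatef p j) (shift x (row (lshift d i) V)) = 0.
      by rewrite E f0E.
    rewrite faddE Hcb sum_shiftL ci addrACA -faddE E2 add0r; exact: addbool_eq0.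
  pose x0 : {ffun 'I_n -> bool} := 0.
  have := H (shift x0 (row (rshift d i) V)); rewrite factorR_shift eqxx (H x0).
  by case: (factorR p i x0).
have S0 : \sum_(j | c (rshift k j)) gatef p j = 0 by rewrite big1 // => j; rewrite c0.
move: E; rewrite S0 addr0 => /gs_ind [-> E]; split=> //.
apply/ffunP=> i; rewrite [RHS]ffunE -(splitK i); case: split => j /=; last exact: c0.
by move/ffunP: E => /(_ j); rewrite !ffunE.
Qed.
End Era.

Lemma base_var n (i : 'I_n) : base n i.+1 = [ffun x : {ffun 'I_n -> bool} => x i].
Proof.
apply/ffunP=> x; rewrite !ffunE /= (nth_map i) ?size_enum_ord //.
by rewrite nth_ord_enum.
Qed.

Lemma is_base_var n (i : 'I_n) : is_base [ffun x : {ffun 'I_n -> bool} => x i].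
Proof. by exists i.+1; rewrite ?base_var. Qed.

(** * Adding selector variables, with XOR-gates free of charge *)

Section Lift.
Variables n t : nat.

Definition liftf (f : bf n) : bf (n + t) :=
  [ffun x : {ffun 'I_(n + t) -> bool} => f [ffun i => x (lshift t i)]].

Lemma liftfE f x : liftf f x = f [ffun i => x (lshift t i)].
Proof. by rewrite ffunE. Qed.

Lemma liftfD f g : liftf (f + g) = liftf f + liftf g.
Proof. by apply/ffunP=> x; rewrite faddE !liftfE faddE. Qed.

Lemma liftf0 : liftf 0 = 0.
Proof. by apply/ffunP=> x; rewrite liftfE !ffunE. Qed.

Lemma liftf_fand f g : liftf (fand f g) = fand (liftf f) (liftf g).
Proof. by apply/ffunP=> x; rewrite fandE !liftfE fandE. Qed.

Lemma liftf_sum (I : Type) (r : seq I) (P : pred I) (G : I -> bf n) :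
  liftf (\sum_(i <- r | P i) G i) = \sum_(i <- r | P i) liftf (G i).
Proof. exact: (big_morph liftf liftfD liftf0). Qed.

Lemma liftf_var (i : 'I_n) : liftf [ffun x : {ffun 'I_n -> bool} => x i]
  = [ffun x : {ffun 'I_(n + t) -> bool} => x (lshift t i)].
Proof. by apply/ffunP=> x; rewrite !ffunE. Qed.

Implicit Types (S : bf (n + t) -> Prop).

Definition has_base S : Prop := forall f, is_base f -> S f.

Lemma computes_sum0 s S (l : seq (bf (n + t))) : computes 0 1 s S -> has_base S ->
    (forall g, g \in l -> S g) ->
  computes 0 1 s (fun f => f = \sum_(g <- l) g \/ S f).
Proof.
move=> cS bS lS; have B0 : S (base (n + t) 0) by apply: bS; exists 0%N.
have c0 := computes_add cS B0 B0; rewrite addff in c0.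
apply: computes_sub (computes_sum c0 (or_introl erefl) (fun g gl => or_intror (lS g gl))).
  by rewrite muln0 !addn0.
by move=> f [->|Sf]; [left; rewrite add0r|right; right].
Qed.

Lemma computes_combination s S k (gs : 'I_k -> bf n) lam c : computes 0 1 s S ->
    has_base S -> (forall i, S (liftf (gs i))) ->
  computes 0 1 s (fun f => f = liftf (combination gs lam c) \/ S f).
Proof.
move=> cS bS gS.
pose l := [seq [ffun x : {ffun 'I_(n + t) -> bool} => x (lshift t i)]
            | i <- enum 'I_n & lam i 0] ++ [seq liftf (gs i) | i <- enum 'I_k & c i].
have -> : liftf (combination gs lam c) = \sum_(g <- l) g.
  rewrite liftfD big_cat /= !big_map !big_filter !big_enum_cond /= liftf_sum.
  congr (_ + _); under eq_bigr => i _ do rewrite -liftf_var.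
  rewrite -liftf_sum; congr liftf; apply/ffunP=> x; rewrite sum_ffunE ffunE [RHS]big_mkcond.
  by apply: eq_bigr => i _; rewrite ffunE; case: (lam i 0); rewrite ?mul1r ?mul0r.
apply: computes_sum0 => // g; rewrite mem_cat => /orP [] /mapP [i _ ->] //.
exact/bS/is_base_var.
Qed.

Lemma computes_era s S k d (gs : 'I_k -> bf n) R K (p : params n k d) :
    computes 0 1 s S -> has_base S -> (forall i, S (liftf (gs i))) ->
  computes 0 1 (s + d) (fun f => [\/ S f, f = liftf (era gs R K p)
     | exists j, f = liftf (gatef gs R K p j)]).
Proof.
move=> cS bS gS.
have H (js : seq 'I_d) : computes 0 1 (s + size js)
    (fun f => S f \/ exists2 j, j \in js & f = liftf (gatef gs R K p j)).
  elim: js => [|j js IH]; first by apply: computes_sub cS; rewrite ?addn0 // => f [//|[]].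
  have c1 := computes_combination (lamL R K p j) (p j).1.2 IH
    (fun f Hf => or_introl (bS f Hf)) (fun i => or_introl (gS i)).
  have c2 := computes_combination (lamR R K p j) (p j).2.2 c1
    (fun f Hf => or_intror (or_introl (bS f Hf)))
    (fun i => or_intror (or_introl (gS i))).
  have c3 := computes_mul c2 (or_intror (or_introl erefl)) (or_introl erefl).
  rewrite -liftf_fand in c3.
  apply: computes_sub c3; first by rewrite /= addn1 addnS.
  move=> f [Sf|[j']]; first by right; right; right; left.
  rewrite inE => /orP [/eqP -> ->|lj ->]; first by left.
  by right; right; right; right; exists j'.
have := @computes_sum0 _ _ [seq liftf (gatef gs R K p j) | j <- enum 'I_d] (H (enum 'I_d))
  (fun f Hf => or_introl (bS f Hf)).
rewrite big_map big_enum -liftf_sum /= => H1.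
apply: computes_sub (H1 _); first by rewrite size_enum_ord.
  move=> f [Sf|->|[j ->]]; first by right; left.
    by left.
  by right; right; exists j; rewrite ?mem_enum.
by move=> g /mapP [j lj ->]; right; exists j.
Qed.

Section Tails.
Variable d : nat.

(** Quantification over [S] lets the earlier products come from any circuit already built; each
    further era costs [d] conjunctions. *)
Definition reachable k (gs : 'I_k -> bf n) r (tl : seq (bf n)) : Prop :=
  forall s S, computes 0 1 s S -> has_base S -> (forall i, S (liftf (gs i))) ->
  computes 0 1 (s + d * r) (fun f => S f \/ exists2 g, g \in tl & f = liftf g).

(** In an era with [k] earlier products, each of the [2 d] factors has [n - 2 d] free linear
    coefficients and [k] coefficients on products; [k] then grows by [d]. *)
Fixpoint tail_bits (k r : nat) : nat :=
  if r is r'.+1 then ((d + d) * (n - (d + d) + k) + tail_bits (k + d) r')%N else 0%N.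

Lemma card_params k : #|{: params n k d}| = (2 ^ ((d + d) * (n - (d + d) + k)))%N.
Proof.
rewrite card_ffun !card_prod card_mx card_ffun !card_ord card_bool muln1.
by rewrite -!expnD -expnM; congr (2 ^ _)%N; lia.
Qed.

(** Induction on the number of eras: by [era_inj] the first function determines its parameters, and
    the induction hypothesis separates the tails. The bound on [n] leaves room for [2 d] fresh
    invariant directions in every era. *)
Lemma distinct_tails r : forall k q (gs : 'I_k -> bf n) (P : 'M[bool]_(n, q)),
    (forall i, shift_invariant P (gs i)) -> independent gs ->
    (q + (d + d) * r <= n)%N ->
  exists T : seq (seq (bf n)), [/\ uniq T, size T = (2 ^ tail_bits k r)%N &
    forall tl, tl \in T -> size tl = r /\ reachable gs r tl].
Proof.
elim: r => [|r IH] k q gs P gsi gsd ln.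
  exists [:: [::]]; split=> // tl; rewrite inE => /eqP ->; split=> // s S cS _ _.
  by apply: computes_sub cS; rewrite ?muln0 ?addn0 // => f [//|[]].
have [|V [R [VP VR]]] := @kernel_dual_family _ n q (d + d) P.
  by apply: leq_trans ln; rewrite leq_add2l mulnS leq_addr.
have [K [K' [VK KK]]] := kernel_parametrization VR.
have Hp (p : params n k d) : exists T : seq (seq (bf n)),
    [/\ uniq T, size T = (2 ^ tail_bits (k + d) r)%N &
    forall tl, tl \in T -> size tl = r /\ reachable (gs_next gs R K p) r tl].
  apply: (IH _ _ _ (P_next P R K p)).
  - exact: gs_next_inv gsi _ _ _.
  - exact: (gs_next_ind gsi gsd VP VR VK).
  - by rewrite -addnA -mulnS.
have [T HT] := fin_all_exists Hp.
exists [seq era gs R K p :: tl | p <- enum {: params n k d}, tl <- T p]; split.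
- apply: allpairs_uniq_dep; rewrite ?enum_uniq //.
    by move=> p _; have [] := HT p.
  move=> [p tl] [p' tl'] _ _ /= [/(era_inj gsi gsd VP VR VK KK) Ep Et].
  by subst p'; rewrite Et.
- rewrite size_allpairs_dep sumnE big_map big_enum /=.
  rewrite (eq_bigr (fun=> 2 ^ tail_bits (k + d) r)%N); last by move=> p _; have [] := HT p.
  by rewrite sum_nat_const card_params -expnD.
move=> _ /allpairsPdep [p [tl [_ tlT ->]]].
have [_ _ /(_ tl tlT) [sz re]] := HT p; split; first by rewrite /= sz.
move=> s S cS bS gS.
have c1 := computes_era R K p cS bS gS.
have c2 := re _ _ c1 (fun f Hf => Or31 _ _ (bS f Hf)).
apply: computes_sub (c2 _).
- by rewrite mulnS addnA.
- move=> f [Sf|[g]]; first by left; apply: Or31.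
  rewrite inE => /orP [/eqP -> ->|gt ->]; first by left; apply: Or32.
  by right; exists g.
- move=> i; rewrite /gs_next; case: split => j; first by apply: Or31.
  by apply: Or33; exists j.
Qed.
End Tails.

Definition multiplex (tl : seq (bf n)) : bf (n + t) :=
  [ffun x : {ffun 'I_(n + t) -> bool} =>
    \sum_(B < t) x (rshift n B) * liftf (nth 0 tl B) x].

(** Setting selector [B] to 1 and the others to 0 isolates entry [B]. *)
Lemma multiplex_inj tl tl' : size tl = t -> size tl' = t ->
  multiplex tl = multiplex tl' -> tl = tl'.
Proof.
move=> s1 s2 E; apply: (@eq_from_nth _ 0); rewrite ?s1 ?s2 // => B lB.
apply/ffunP=> y.
pose x : {ffun 'I_(n + t) -> bool} :=
  [ffun i => match split i with inl i => y i | inr B' => B' == Ordinal lB end].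
have Ex tl0 : multiplex tl0 x = nth 0 tl0 B y.
  rewrite ffunE (bigD1 (Ordinal lB)) //= big1.
    rewrite addr0 ffunE (unsplitK (inr _)) eqxx mul1r liftfE; congr (nth 0 tl0 B _).
    by apply/ffunP=> i; rewrite !ffunE (unsplitK (inl _)).
  by move=> B' ne; rewrite ffunE (unsplitK (inr _)) (negbTE ne) mul0r.
by rewrite -!Ex E.
Qed.

Lemma computes_multiplex d tl (gs : 'I_0 -> bf n) : size tl = t -> reachable d gs t tl ->
  computes 0 1 (d * t + t) (eq (multiplex tl)).
Proof.
move=> sz re.
have c0 := re _ _ (computes_base 0 1 (n + t)) (fun f Hf => Hf).
have {c0} := c0 (fun i : 'I_0 => match i with Ordinal _ li => match notF li with end end).
rewrite add0n => c0.
pose pr (B : 'I_t) : bf (n + t) :=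
  fand [ffun x : {ffun 'I_(n + t) -> bool} => x (rshift n B)] (liftf (nth 0 tl B)).
have H (Bs : seq 'I_t) : computes 0 1 (d * t + size Bs) (fun f =>
    (is_base f \/ exists2 g, g \in tl & f = liftf g) \/ exists2 B, B \in Bs & f = pr B).
  elim: Bs => [|B Bs IH]; first by apply: computes_sub c0; rewrite ?addn0 // => f [//|[]].
  have lB : exists2 g, g \in tl & liftf (nth 0 tl B) = liftf g.
    by exists (nth 0 tl B); rewrite ?mem_nth ?sz.
  have := computes_mul IH (or_introl (or_introl (is_base_var (rshift n B))))
    (or_introl (or_intror lB)).
  apply: computes_sub; first by rewrite /= addn1 addnS.
  move=> f [|[B']]; first by right; left.
  rewrite inE => /orP [/eqP -> ->|lB' ->]; first by left.
  by right; right; exists B'.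
have := @computes_sum0 _ _ [seq pr B | B <- enum 'I_t] (H (enum 'I_t))
  (fun f Hf => or_introl (or_introl Hf)).
move=> H1; apply: computes_sub (H1 _).
- by rewrite size_enum_ord.
- move=> _ <-; left; rewrite big_map big_enum /=; apply/ffunP=> x.
  by rewrite sum_ffunE [LHS]ffunE; apply: eq_bigr => B _; rewrite !ffunE.
- by move=> g /mapP [B lB ->]; right; exists B.
Qed.
End Lift.

(** The eras start from no product and a matrix without columns. The [t] eras use [d] conjunctions
    each, and each selector one more. *)
Lemma hard_class n t d : ((d + d) * t <= n)%N ->
  exists A : {set bf (n + t)}, #|A| = (2 ^ tail_bits n d 0 t)%N /\
    forall f, f \in A -> computes 0 1 (d * t + t) (eq f).
Proof.
move=> ln; pose gs (i : 'I_0) : bf n := 0.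
have [||//|T [uT sT HT]] := @distinct_tails n t d t 0 0 gs 0.
- by case.
- move=> lam c; rewrite /combination big_pred0; last by case.
  by rewrite addr0 => /lin_eq0 ->; split=> //; apply/ffunP; case.
exists [set f in map (@multiplex n t) T]; split.
  rewrite cardsE; have /card_uniqP -> : uniq (map (@multiplex n t) T).
    rewrite map_inj_in_uniq // => tl tl' /HT [s1 _] /HT [s2 _].
    exact: multiplex_inj.
  by rewrite size_map.
move=> f; rewrite inE => /mapP [tl /HT [sz re] ->].
exact: computes_multiplex re.
Qed.

Lemma tail_bitsE n d k r : (tail_bits n d k r =
  (d + d) * (n - (d + d) + k) * r + d * d * (r * r.-1))%N.
Proof.
elim: r k => [|r IH] k; first by rewrite /= !muln0.
rewrite /= IH; case: r {IH} => [|r] /=; lia.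
Qed.

(** * Asymptotics *)

Local Close Scope ring_scope.
Local Open Scope R_scope.

Lemma INR_addn a b : INR (a + b)%N = INR a + INR b.
Proof. exact: plus_INR. Qed.

Lemma INR_muln a b : INR (a * b)%N = INR a * INR b.
Proof. exact: mult_INR. Qed.

Lemma INR_leq a b : (a <= b)%N -> INR a <= INR b.
Proof. by move/leP; apply: le_INR. Qed.

Lemma INR_expn2 k : INR (2 ^ k)%N = 2 ^ k.
Proof. by elim: k => [|k IH] //; rewrite expnS INR_muln IH. Qed.

Lemma leq_INR a b : INR a <= INR b -> (a <= b)%N.
Proof. by move=> H; apply/leP/INR_le. Qed.

Lemma ln2_gt0 : 0 < ln 2.
Proof. by rewrite -ln_1; apply: ln_increasing; lra. Qed.

Lemma log2_pow k : log2 (2 ^ k) = INR k.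
Proof.
by rewrite /log2 ln_pow; [field; have := ln2_gt0; lra|lra].
Qed.

Lemma log2_le x y : 0 < x -> x <= y -> log2 x <= log2 y.
Proof.
move=> x0 xy; rewrite /log2; apply: Rmult_le_compat_r.
  by apply/Rlt_le/Rinv_0_lt_compat/ln2_gt0.
by case: xy => [lt|->]; [apply/Rlt_le/ln_increasing|lra].
Qed.

Lemma log2_trunc M : (0 < M)%N -> 
  INR (trunc_log 2 M) <= log2 (INR M) <= INR (trunc_log 2 M) + 1.
Proof.
move=> M0; set L := trunc_log 2 M.
have [l1 l2] : (2 ^ L <= M)%N /\ (M <= 2 ^ L.+1)%N.
  by split; [rewrite trunc_logP|rewrite ltnW // trunc_log_ltn].
have p1 := pow_lt 2 L ltac:(lra).
have M0' : 0 < INR M by apply: lt_0_INR; apply/ltP.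
split.
  by rewrite -log2_pow; apply: log2_le => //; rewrite -INR_expn2; apply: INR_leq.
rewrite -S_INR -(log2_pow L.+1); apply: log2_le => //.
by rewrite -INR_expn2; apply: INR_leq.
Qed.

(** * Real estimates for the cost of the strips *)

Lemma strip_estimate (M n h b m T L z Q U : R) :
  64 <= L -> L * L * L <= M -> 1 <= h -> h <= L -> L <= 4 * h -> 0 <= b ->
  b * h <= M + h -> 1 <= m -> m * (L * L) <= M -> 0 <= T -> T * L <= 4 * m ->
  0 <= z -> z * m <= n + 1 + b * h -> 0 <= n -> n + 1 <= Q * M -> 1 <= Q ->
  4 * U <= 2 * (b * (n + 1)) + h * (b * b) +
    2 * (b * (T * (z + 1) + 4 * h * T + h * (4 * h + 2 + 2 * m))
         + 2 * ((n + 1) * m) + 2 * (n + 1 + b * h) + 2) ->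
  U <= M * (M + 2 * n) / (4 * h) + 100 * Q * (M * M) / (L * L).
Proof.
move=> HL LM h1 hL Lh b0 bh m1 mM T0 TL z0 zm n0 nM Q1 HU.
have LL : 1 <= L * L by nra.
have LLM : L * L <= M by nra.
have hM : h <= M by nra.
have M1 : 1 <= M by nra.
set B := b * h in bh zm HU *.
have B0 : 0 <= B by rewrite /B; nra.
have B2 : B <= 2 * M by lra.
have bL : b * L <= 8 * M by rewrite /B in B2; nra.
set Z := n + 1 + B in zm HU *.
have Z0 : 0 <= Z by rewrite /Z; lra.
have ZM : Z <= (Q + 2) * M by rewrite /Z; lra.
have TzL : T * z * L <= 4 * Z by nra.
have Tz0 : 0 <= T * z by nra.
have mM' : m <= M by nra.
have bL0 : 0 <= b * L by nra.
(* The bounds [e1] to [e8] show that every error term, multiplied by [L * L], is at most a multiple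
   of [M * M], with a coefficient at most linear in [Q]. *)
have e1 : b * (T * z) * (L * L) <= 32 * (Q + 2) * (M * M).
  have -> : b * (T * z) * (L * L) = (b * L) * (T * z * L) by ring.
  apply: Rle_trans (_ : (8 * M) * (4 * ((Q + 2) * M)) <= _); last by nra.
  by apply: Rmult_le_compat; nra.
have e2 : b * T * (L * L) <= 32 * (M * M).
  have -> : b * T * (L * L) = (b * L) * (T * L) by ring.
  apply: Rle_trans (_ : (8 * M) * (4 * M) <= _); last by nra.
  by apply: Rmult_le_compat; nra.
have TLL : T * (L * L) <= 4 * M.
  apply: Rle_trans (_ : 4 * m * L <= _); first by nra.
  by nra.
have TLL0 : 0 <= T * (L * L) by apply: Rmult_le_pos; lra.
have e3 : 4 * B * (T * (L * L)) <= 32 * (M * M).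
  apply: Rle_trans (_ : (8 * M) * (4 * M) <= _); last by nra.
  by apply: Rmult_le_compat; nra.
have e4 : B * (4 * h + 2) * (L * L) <= 12 * (M * M).
  have -> : B * (4 * h + 2) * (L * L) = B * ((4 * h + 2) * (L * L)) by ring.
  apply: Rle_trans (_ : (2 * M) * (6 * M) <= _); last by nra.
  by apply: Rmult_le_compat; nra.
have e5 : B * (2 * m) * (L * L) <= 4 * (M * M).
  have -> : B * (2 * m) * (L * L) = B * (2 * (m * (L * L))) by ring.
  apply: Rle_trans (_ : (2 * M) * (2 * M) <= _); last by nra.
  by apply: Rmult_le_compat; nra.
have e6 : 2 * ((n + 1) * m) * (L * L) <= 2 * Q * (M * M).
  have -> : 2 * ((n + 1) * m) * (L * L) = (2 * (n + 1)) * (m * (L * L)) by ring.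
  apply: Rle_trans (_ : (2 * (Q * M)) * M <= _); last by nra.
  by apply: Rmult_le_compat; nra.
have e7 : (2 * Z + 2) * (L * L) <= (2 * Q + 6) * (M * M).
  apply: Rle_trans (_ : ((2 * Q + 6) * M) * M <= _); last by nra.
  by apply: Rmult_le_compat; nra.
have e8 : (2 * M / h + 2 * (n + 1) + 2 * M + h) * (L * L) <= (2 * Q + 5) * (M * M).
  have dh : 2 * M / h <= 2 * M.
    by apply: (Rmult_le_reg_r h); [lra|field_simplify; [nra|lra]].
  have dh0 : 0 <= 2 * M / h by apply: Rle_mult_inv_pos; lra.
  apply: Rle_trans (_ : ((2 * Q + 5) * M) * M <= _); last by nra.
  by apply: Rmult_le_compat; nra.
(* The main term, using [b * h <= M + h]; the rounding excess is the quantity bounded in [e8]. *)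
have e9 : 2 * (b * (n + 1)) + h * (b * b) <=
    M * (M + 2 * n) / h + (2 * M / h + 2 * (n + 1) + 2 * M + h).
  apply: (Rmult_le_reg_r h); first lra.
  have -> : (M * (M + 2 * n) / h + (2 * M / h + 2 * (n + 1) + 2 * M + h)) * h
    = M * (M + 2 * n) + 2 * M + 2 * (n + 1) * h + 2 * M * h + h * h by field; lra.
  have -> : (2 * (b * (n + 1)) + h * (b * b)) * h = 2 * (n + 1) * B + B * B.
    by rewrite /B; ring.
  have := Rmult_le_compat_l (2 * (n + 1)) _ _ ltac:(lra) bh.
  have := Rmult_le_compat _ _ _ _ B0 B0 bh bh.
  by lra.
have E : U * (L * L) <= M * (M + 2 * n) / (4 * h) * (L * L) + 100 * Q * (M * M).
  have -> : M * (M + 2 * n) / (4 * h) = M * (M + 2 * n) / h / 4 by field; lra.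
  have MM : 1 <= M * M by nra.
  set W := M * (M + 2 * n) / h in e9 *.
  set Y := 2 * M / h + _ + _ + _ in e8 e9.
  have := Rmult_le_compat_r (L * L) _ _ ltac:(lra) HU.
  have := Rmult_le_compat_r (L * L) _ _ ltac:(lra) e9.
  have QM : M * M <= Q * (M * M).
    by rewrite -{1}[M * M]Rmult_1_l; apply: Rmult_le_compat_r; lra.
  rewrite /Z /B in e3 e4 e5 e7 *.
  by lra.
apply: (Rmult_le_reg_r (L * L)); first lra.
rewrite Rmult_plus_distr_r.
have -> : 100 * Q * (M * M) / (L * L) * (L * L) = 100 * Q * (M * M) by field; nra.
exact: E.
Qed.

Lemma leq_6_exp2 s : (7 <= s -> 6 * s <= 2 ^ s.-1)%N.
Proof.
case: s => // s; elim: s => // s IH ls; rewrite expnS.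
have [ls'|] := leqP 7 s.+1; first by move: (IH ls') => /=; lia.
by move=> ls'; have -> : s = 5%N by lia.
Qed.

Lemma leq_sqr_exp2 s : (7 <= s -> s * s <= 2 ^ s.-1)%N.
Proof.
case: s => // s; elim: s => // s IH ls; rewrite expnS.
have [ls'|] := leqP 7 s.+1; first by move: (IH ls') => /=; nia.
by move=> ls'; have -> : s = 5%N by lia.
Qed.

Lemma leq_cube_exp2 L : (10 <= L -> L * L * L <= 2 ^ L)%N.
Proof.
elim: L => // L IH lL; rewrite expnS.
have [lL'|] := leqP 10 L; first by move: (IH lL') => /=; nia.
by move=> lL'; have -> : L = 9%N by lia.
Qed.

(* With [L ~ log2 M], strips have [2 h ~ L - O(log L)] rows and blocks have
   [m ~ M / L ^ 2] columns, so that [2 ^ (2 h) = O(m / L)]. *)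
Section StripSizes.
Variable M : nat.

Definition lgM : nat := trunc_log 2 M.
Definition lglgM : nat := (trunc_log 2 lgM).+1.
Definition block : nat := (2 ^ (lgM - 2 * lglgM))%N.
Definition half_strip : nat := ((lgM - 3 * lglgM)./2.+1)%N.
Definition strips : nat := ((M %/ half_strip).+1)%N.

Lemma block_gt0 : (0 < block)%N. Proof. by rewrite expn_gt0. Qed.

Lemma leq_strips : (M <= strips * half_strip)%N.
Proof. by rewrite ltnW // ltn_ceil. Qed.

Hypothesis lgM_ge : (64 <= lgM)%N.

(** From [64 <= lgM] follows [7 <= lglgM], where [6 s] and [s * s] are below [2 ^ (s - 1)]; and
    [2 ^ (lglgM - 1) <= lgM]. *)
Lemma lglgM_bounds : [/\ (lgM < 2 ^ lglgM)%N, (6 * lglgM <= lgM)%N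
  & (lglgM * lglgM <= lgM)%N].
Proof.
have l1 : (lgM < 2 ^ lglgM)%N by apply: trunc_log_ltn.
have s7 : (7 <= lglgM)%N.
  by rewrite -(ltn_exp2l 6 lglgM (ltnSn 1)); apply: leq_ltn_trans l1.
have l2 : (2 ^ lglgM.-1 <= lgM)%N by rewrite trunc_logP //; lia.
split=> //; apply: leq_trans l2; first exact: leq_6_exp2.
exact: leq_sqr_exp2.
Qed.

Lemma half_strip_bounds : [/\ (lgM - 3 * lglgM + 1 <= half_strip + half_strip)%N
  & (half_strip + half_strip <= lgM - 3 * lglgM + 2)%N].
Proof.
rewrite /half_strip; have := odd_double_half (lgM - 3 * lglgM).
by case: odd; lia.
Qed.

Lemma exp_lgM : (2 ^ lgM <= M)%N.
Proof. by apply: trunc_logP => //; move: lgM_ge; rewrite /lgM; case: (M). Qed.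

Lemma block_le : (block * (lgM * lgM) <= M)%N.
Proof.
have [l1 l6 _] := lglgM_bounds; apply: leq_trans exp_lgM.
have -> : (2 ^ lgM = block * (2 ^ lglgM * 2 ^ lglgM))%N.
  by rewrite /block -!expnD; congr (2 ^ _)%N; lia.
by rewrite !leq_mul // ltnW.
Qed.

(** Two of the three [lglgM] subtracted in [half_strip] match those in [block]; the third gains the
    factor [lgM], which makes the leftover columns negligible. *)
Lemma patterns_le : (2 ^ (half_strip + half_strip) * lgM <= 4 * block)%N.
Proof.
have [l1 l6 _] := lglgM_bounds; have [_ lh] := half_strip_bounds.
apply: (@leq_trans (2 ^ (lgM - 3 * lglgM + 2) * 2 ^ lglgM)%N).
  by rewrite leq_mul ?leq_pexp2l // ltnW.
rewrite -expnD /block -[4%N]/(2 ^ 2)%N -expnD leq_pexp2l //; lia.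
Qed.

Lemma strips_le : (strips * half_strip <= M + half_strip)%N.
Proof. by rewrite /strips mulSn addnC leq_add2r leq_trunc_div. Qed.

Lemma upper_cost_estimate (n : nat) (Q : R) : 1 <= Q -> INR n + 1 <= Q * INR M ->
  INR (upper_cost n block half_strip strips) <=
  INR M * (INR M + 2 * INR n) / (4 * INR half_strip)
  + 100 * Q * (INR M * INR M) / (INR lgM * INR lgM).
Proof.
move=> Q1 nM; have [l1 l6 _] := lglgM_bounds; have [lh1 lh2] := half_strip_bounds.
have h1 : (1 <= half_strip)%N by [].
have hL : (half_strip <= lgM)%N by lia.
have Lh : (lgM <= 4 * half_strip)%N by lia.
have cube : (lgM * lgM * lgM <= M)%N.
  by apply: leq_trans exp_lgM; apply: leq_cube_exp2; lia.
set Z := (n.+1 + strips * half_strip)%N.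
have zm : (Z %/ block * block <= Z)%N by apply: leq_trunc_div.
have := upper_cost_le n half_strip strips block_gt0; rewrite -/Z.
have := block_le; have := patterns_le; have := strips_le; have := block_gt0.
have L64 := lgM_ge; move: (upper_cost _ _ _ _) => U.
move: (2 ^ (half_strip + half_strip))%N => T.
rewrite /Z in zm *; move: {Z} (_ %/ block)%N zm h1 hL Lh cube L64 => z.
move: strips half_strip block lgM => b h m L.
move=> /INR_leq I6 /INR_leq I7 /INR_leq I8 /INR_leq I9 /INR_leq I10 /INR_leq I11.
move=> /INR_leq I1 /INR_leq I2 /INR_leq I3 /INR_leq I4 /INR_leq I5.
have E4 : INR 4 = 4 by rewrite /=; lra.
have E2 : INR 2 = 2 by rewrite /=; lra.
have E1 : INR 1 = 1 by [].
have E64 : INR 64 = 64 by rewrite INR_IZR_INZ.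
rewrite !(E4, E2, E1, E64, INR_addn, INR_muln, S_INR)
  in I1 I2 I3 I4 I5 I6 I7 I8 I9 I10 I11.
by apply: (@strip_estimate _ _ _ (INR b) (INR m) (INR T) (INR L) (INR z));
  try exact: pos_INR; lra.
Qed.
End StripSizes.

(** Here [r] is the square root of [L], and [s <= r] turns the relative loss of order [s / L] from
    the strip height into [1 / r]. The other error is compared with [W] through [M * M <= W]. *)
Lemma eps_estimate (U W M L s h r l Q : R) :
  64 <= L -> 0 < h -> 6 * s <= L -> 0 <= s -> L - 3 * s + 1 <= 2 * h ->
  0 < r -> r * r = L -> s <= r -> 0 < l -> l <= L + 1 -> 0 <= Q -> M * M <= W ->
  U <= W / (4 * h) + 100 * Q * (M * M) / (L * L) ->
  U <= (/ 2 + (3 + 200 * Q) / r) * W / l.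
Proof.
move=> HL h0 s6 s0 hs r0 rr sr l0 lL Q0 WM HU.
have W0 : 0 <= W by nra.
have r1 : 1 <= r by nra.
have e1 : l / (4 * h) <= / 2 + 3 / r.
  apply: Rle_trans (_ : / 2 + 3 * s / L <= _); last first.
    apply: Rplus_le_compat_l; rewrite -rr.
    apply: (Rmult_le_reg_r (r * r)); first nra.
    have -> : 3 * s / (r * r) * (r * r) = 3 * s by field; lra.
    have -> : 3 / r * (r * r) = 3 * r by field; lra.
    lra.
  apply: (Rmult_le_reg_r (4 * h)); first lra.
  have -> : l / (4 * h) * (4 * h) = l by field; lra.
  apply: Rle_trans (_ : (/ 2 + 3 * s / L) * (2 * (L - 3 * s + 1)) <= _).
    apply: (Rmult_le_reg_r L); first lra.
    have -> : (/ 2 + 3 * s / L) * (2 * (L - 3 * s + 1)) * L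
      = (L + 6 * s) * (L - 3 * s + 1) by field; lra.
    have := Rmult_le_compat_r L _ _ ltac:(lra) lL.
    (* The excess of [(L + 6 s) (L - 3 s + 1)] over [L (L + 1)] is [3 s (L - 6 s) + 6 s]. *)
    have := Rmult_le_pos s (L - 6 * s) s0 ltac:(lra).
    by lra.
  apply: Rmult_le_compat_l; last lra.
  have : 0 <= 3 * s / L by apply: Rle_mult_inv_pos; lra.
  by lra.
have e2 : l * (100 * Q / (L * L)) <= 200 * Q / r.
  have -> : 200 * Q / r = (200 * Q * (r * r * r)) / (L * L) by rewrite -rr; field; lra.
  have -> : l * (100 * Q / (L * L)) = (l * (100 * Q)) / (L * L) by field; lra.
  apply: Rmult_le_compat_r; first by apply/Rlt_le/Rinv_0_lt_compat; nra.
  have l2 : l <= 2 * L by lra.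
  have Lr : L <= r * r * r by rewrite -rr; nra.
  by nra.
apply: (Rmult_le_reg_r l) => //.
have -> : (/ 2 + (3 + 200 * Q) / r) * W / l * l
  = (/ 2 + 3 / r) * W + 200 * Q / r * W by field; lra.
have := Rmult_le_compat_r l _ _ ltac:(lra) HU.
have -> : (W / (4 * h) + 100 * Q * (M * M) / (L * L)) * l
  = l / (4 * h) * W + l * (100 * Q / (L * L)) * (M * M) by field; lra.
have := Rmult_le_compat_r W _ _ W0 e1.
have LQ : 0 <= l * (100 * Q / (L * L)).
  apply: Rmult_le_pos; first lra.
  by apply: Rle_mult_inv_pos; nra.
have := Rmult_le_compat _ _ _ _ LQ (Rle_0_sqr M) e2 WM; rewrite /Rsqr.
by lra.
Qed.

(** For small [M], only finitely many [n] satisfy [c n <= M], and the value dominates the sum of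
    their upper costs. For large [M], the constant is that of [eps_estimate] with [Q = / c + 1]. *)
Definition eps_of (c : R) (M : nat) : R :=
  if (64 <= lgM M)%N then (3 + 200 * (/ c + 1)) / sqrt (INR (lgM M))
  else INR (\sum_(n < (Z.to_nat (up (INR M / c))).+1)
             upper_cost n (block M) (half_strip M) (strips M)) * log2 (INR M).

Lemma eps_of_cv c : 0 < c -> Un_cv (eps_of c) 0.
Proof.
move=> c0 e e0; set A := 3 + 200 * (/ c + 1).
have A0 : 0 < A by have := Rinv_0_lt_compat c c0; rewrite /A; lra.
(* The quotient of [A] by the square root of [lgM M] is below [e] once [lgM M] exceeds the square of
   [A / e]. *)
pose k := Z.to_nat (up (A / e * (A / e))).
have Hk : A / e * (A / e) < INR k.
  have [u1 _] := archimed (A / e * (A / e)).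
  have Ae : 0 <= A / e * (A / e) by apply: Rle_0_sqr.
  have up0 : Z.le Z0 (up (A / e * (A / e))) by apply: le_IZR; lra.
  by rewrite /k INR_IZR_INZ Z2Nat.id.
exists (2 ^ (64 + k))%N => M /leP lM.
have M0 : (0 < M)%N by apply: leq_trans lM; rewrite expn_gt0.
have LM : (64 + k <= lgM M)%N by rewrite /lgM trunc_log_max.
have L64 : (64 <= lgM M)%N by apply: leq_trans LM; rewrite leq_addr.
rewrite /eps_of L64 -/A /R_dist Rminus_0_r.
have kL : A / e * (A / e) < INR (lgM M).
  by apply: Rlt_le_trans Hk _; apply: INR_leq; apply: leq_trans LM; rewrite leq_addl.
have Ae0 : 0 < A / e by apply: Rdiv_lt_0_compat.
have sq : A / e < sqrt (INR (lgM M)).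
  rewrite -(sqrt_square (A / e)); last lra.
  by apply: sqrt_lt_1_alt; split=> //; apply: Rle_0_sqr.
have s0 : 0 < sqrt (INR (lgM M)) by lra.
rewrite Rabs_right; last by apply/Rle_ge/Rlt_le/Rdiv_lt_0_compat.
apply: (Rmult_lt_reg_r (sqrt (INR (lgM M)))) => //.
have -> : A / sqrt (INR (lgM M)) * sqrt (INR (lgM M)) = A by field; lra.
have := Rmult_lt_compat_l e _ _ e0 sq.
by have -> : e * (A / e) = A by field; lra.
Qed.

(** Assumes at most [M] conjunctions instead of exactly [M]: the lower bound applies it with a
    rounded-up count. *)
Lemma upper_part c : 0 < c -> forall (n : nat) (f : boolfun n) (M : nat),
  (1 < M)%N -> c * INR n <= INR M ->
  (exists C, implements C f /\ (circ_mult C <= M)%N) ->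
  exists C', implements C' f /\
    INR (circ_size C') <=
      (/ 2 + eps_of c M) * (INR M * (INR M + 2 * INR n)) / log2 (INR M).
Proof.
move=> c0 n f M M1 cn [C [impC mC]].
have lC : (circ_mult C <= strips M * half_strip M)%N by rewrite (leq_trans mC) ?leq_strips.
have [C' [impC' sC']] := upper_bound (block_gt0 M) impC lC.
exists C'; split=> //; move/INR_leq: sC' => sC'; apply: Rle_trans sC' _.
have n0 := pos_INR n.
have M2 : 2 <= INR M by have := INR_leq M1; rewrite /=; lra.
have l0 : 0 < log2 (INR M).
  have := log2_le (x := 2) (y := INR M) ltac:(lra) M2.
  by have := log2_pow 1; rewrite pow_1 /=; lra.
have nM : INR n <= INR M / c.
  by apply: (Rmult_le_reg_l c) => //; have -> : c * (INR M / c) = INR M by field; lra.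
have W1 : INR M * INR M <= INR M * (INR M + 2 * INR n) by nra.
have W0 : 0 < INR M * INR M by nra.
rewrite /eps_of; case: ifP => L64.
  have ci := Rinv_0_lt_compat c c0.
  have Mc : INR M / c = / c * INR M by rewrite /Rdiv; ring.
  have H := @upper_cost_estimate M L64 n (/ c + 1) ltac:(lra) ltac:(lra).
  have [_ l6 ls] := lglgM_bounds L64; have [lh _] := half_strip_bounds L64.
  have [_ lL] := log2_trunc (ltnW M1).
  have E64 : INR 64 = 64 by rewrite INR_IZR_INZ.
  have L64' := INR_leq L64; rewrite E64 in L64'.
  have ls' := INR_leq ls; rewrite INR_muln in ls'.
  have s0 := pos_INR (lglgM M).
  have E6 : INR 6 = 6 by rewrite /=; lra.
  have l6' := INR_leq l6; rewrite INR_muln E6 in l6'.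
  have lh' : INR (lgM M) - 3 * INR (lglgM M) + 1 <= 2 * INR (half_strip M).
    have /INR_leq : (lgM M + 1 <= 2 * half_strip M + 3 * lglgM M)%N by lia.
    rewrite !(INR_addn, INR_muln).
    have -> : INR 2 = 2 by rewrite /=; lra.
    have -> : INR 3 = 3 by rewrite /=; lra.
    have -> : INR 1 = 1 by [].
    by lra.
  apply: (@eps_estimate _ _ (INR M) (INR (lgM M)) (INR (lglgM M)) (INR (half_strip M))) => //.
  - by rewrite /half_strip S_INR; have := pos_INR (lgM M - 3 * lglgM M)./2; lra.
  - by apply: sqrt_lt_R0; lra.
  - by apply: sqrt_sqrt; lra.
  - by rewrite -(sqrt_square (INR (lglgM M))) //; apply: sqrt_le_1_alt.
  - lra.
set B := \sum_(i < _) _; set W := INR M * (INR M + 2 * INR n).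
have UB : INR (upper_cost n (block M) (half_strip M) (strips M)) <= INR B.
  have ln : (n < (Z.to_nat (up (INR M / c))).+1)%N.
    have [u1 _] := archimed (INR M / c).
    have up0 : Z.le Z0 (up (INR M / c)) by apply: le_IZR; lra.
    by apply: leq_INR; rewrite !S_INR (INR_IZR_INZ (Z.to_nat _)) Z2Nat.id //; lra.
  by apply: INR_leq; rewrite /B (bigD1 (Ordinal ln)) //= leq_addr.
apply: Rle_trans UB _.
have B0 := pos_INR B.
apply: (Rmult_le_reg_r (log2 (INR M))) => //.
have -> : (/ 2 + INR B * log2 (INR M)) * W / log2 (INR M) * log2 (INR M)
  = / 2 * W + INR B * log2 (INR M) * W by field; lra.
have W1' : 1 <= W by rewrite /W; nra.
have := Rmult_le_compat_l (INR B * log2 (INR M)) _ _ ltac:(nra) W1'.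
by lra.
Qed.

(** * Numerical form of the counting bound *)

Lemma leq_bin_exp2 n m : ('C(n, m) <= 2 ^ n)%N.
Proof.
elim: n m => [|n IH] [|m] //; first by rewrite bin0 expn_gt0.
by rewrite binS expnS mul2n -addnn leq_add.
Qed.

(** The falling factorial of [2 L] of length [L] has factors at least [L], and equals [L!] times a
    binomial coefficient at most [4 ^ L]. *)
Lemma leq_expn_fact L : (L ^ L <= 4 ^ L * L`!)%N.
Proof.
have H k : (k <= L -> L ^ k <= (L + L) ^_ k)%N.
  elim: k => // k IH lk; rewrite ffactnSr expnSr leq_mul ?IH 1?ltnW //.
  by lia.
apply: leq_trans (H L (leqnn L)) _; rewrite -bin_ffact leq_mul2r.
by rewrite -[4%N]/(2 ^ 2)%N -expnM mul2n -addnn leq_bin_exp2 orbT.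
Qed.

(** With [n.+1 + L <= 2 L], the count is at most about [(8 L L) ^ L]: one power [L ^ L] is absorbed
    by [L!], the other is at most [2 ^ (2 l L)]. The constant 7 collects 3 from the 8, 2 from
    [leq_expn_fact], and 1 for each outer factor. *)
Lemma few_small_circuits n L l E : (n < L)%N -> (L <= 2 ^ (2 * l))%N ->
    (L * (2 * l + 7) < E)%N ->
  (L.+1 * ((2 * (n.+1 + L) * (n.+1 + L)) ^ L * (n.+1 + L)) < 2 ^ E * L`!)%N.
Proof.
move=> nL Ll LE.
have N2 : (n.+1 + L <= 2 * L)%N by lia.
have e1 : ((2 * (n.+1 + L) * (n.+1 + L)) ^ L <= (8 * L * L) ^ L)%N.
  by apply: leq_expn2r; have := leq_mul N2 N2; lia.
have e2 : ((8 * L * L) ^ L <= 2 ^ (5 * L + 2 * l * L) * L`!)%N.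
  rewrite !expnMn; have := leq_mul (leq_expn2r L Ll) (leq_expn_fact L).
  rewrite -expnM => H.
  have -> : (2 ^ (5 * L + 2 * l * L) * L`! = 8 ^ L * (2 ^ (2 * l * L) * (4 ^ L * L`!)))%N.
    by rewrite -[8%N]/(2 ^ 3)%N -[4%N]/(2 ^ 2)%N -!expnM !mulnA -!expnD; congr (2 ^ _ * _)%N; lia.
  by rewrite -mulnA leq_mul2l H orbT.
have L1 : (L.+1 <= 2 ^ L)%N by apply: ltn_expl.
have L2 : (2 * L <= 2 ^ L)%N.
  by case: (L) => // k; rewrite expnS leq_mul2l ltn_expl.
apply: (@leq_ltn_trans (2 ^ L * ((2 ^ (5 * L + 2 * l * L) * L`!) * 2 ^ L))%N).
  apply: leq_mul => //; apply: leq_mul; first exact: leq_trans e2.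
  exact: leq_trans L2.
have -> : (2 ^ L * ((2 ^ (5 * L + 2 * l * L) * L`!) * 2 ^ L) = 2 ^ (L * (2 * l + 7)) * L`!)%N.
  by rewrite mulnAC mulnA -!expnD; congr (2 ^ _ * _)%N; lia.
by rewrite ltn_mul2r fact_gt0 ltn_exp2l.
Qed.

Lemma hard_function n t d L l : ((d + d) * t <= n)%N -> (n + t < L)%N ->
    (L <= 2 ^ (2 * l))%N -> (L * (2 * l + 7) < tail_bits n d 0 t)%N ->
  exists f : boolfun (n + t),
    (exists C, implements C f /\ (circ_mult C <= d * t + t)%N) /\
    (forall C, implements C f -> (L < circ_size C)%N).
Proof.
move=> ln nL Ll LE; have [A [cA HA]] := hard_class ln.
have [f [fA Hf]] : exists f, f \in A /\ forall C, implements C (fun x => f x) -> (L < size C)%N.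
  apply: NNPP => no.
  have /card_small_circuits : forall f, f \in A -> exists C,
      [/\ wf_circuit (n + t) C, (size C <= L)%N &
       exists2 v, (v < (n + t).+1 + size C)%N & node (n + t) C v = f].
    move=> f fA; apply: NNPP => noC; apply: no; exists f; split=> // C.
    move/implementsE=> [wfC [v lv Ev]]; rewrite ltnNge; apply/negP => sC.
    apply: noC; exists C; split=> //; exists v => //.
    by rewrite Ev; apply/ffunP=> x; rewrite ffunE.
  by rewrite cA leqNgt (few_small_circuits nL Ll LE).
exists (fun x => f x); split=> //.
have [C [wfC cC /(_ _ erefl) [v lv Ev]]] := HA f fA.
exists C; rewrite -cost_mult; split=> //; apply/implementsE; split=> //.
by exists v => //; rewrite Ev; apply/ffunP=> x; rewrite ffunE.
Qed.

Lemma least_nat (P : nat -> Prop) : (exists n, P n) ->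
  exists n, P n /\ forall m, P m -> (n <= m)%N.
Proof.
move=> [n]; have [k] := ubnP n; elim: k n => // k IH n ln Pn.
have [[m [Pm lm]]|no] := classic (exists m, P m /\ (m < n)%N).
  by apply: (IH m) => //; apply: leq_trans lm _; rewrite -ltnS.
exists n; split=> // m Pm; rewrite leqNgt; apply/negP=> lm.
by apply: no; exists m.
Qed.

Lemma mult_complexity_exists n (f : boolfun n) C : implements C f ->
  exists M, mult_complexity f M.
Proof.
move=> impC; have [M [HM least]] :=
  @least_nat (fun M => exists C, implements C f /\ circ_mult C = M)
    (ex_intro _ _ (ex_intro _ C (conj impC erefl))).
by exists M; split=> // C' impC'; apply: least; exists C'.
Qed.

(** * Parameters of the hard functions *)

Section Sizes.
Variable n : nat.

(** With [b] eras of [b] products, the factors involve [2 b ^ 2 <= n / 2] linear forms, while the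
    [b ^ 2 + b] conjunctions remain of order [n]. *)
Definition eras : nat := Nat.sqrt (n %/ 4).
Definition class_bits : nat := tail_bits (n - eras) eras 0 eras.
(** The predecessor yields the strict inequality required by [hard_function]. *)
Definition hard_size : nat := (class_bits.-1 %/ (2 * (trunc_log 2 n).+1 + 7))%N.

Lemma eras_bounds : (4 * (eras * eras) <= n)%N /\ (n < 4 * (eras.+1 * eras.+1))%N.
Proof.
have [l1 l2] := Nat.sqrt_spec (n %/ 4) (Nat.le_0_l _).
have {}l1 : (eras * eras <= n %/ 4)%N by apply/leP.
have {}l2 : (n %/ 4 < eras.+1 * eras.+1)%N by apply/leP.
move: (divn_eq n 4) (ltn_pmod n (isT : 0 < 4)%N) l1 l2.
by move: (n %/ 4)%N (n %% 4)%N (eras * eras)%N (eras.+1 * eras.+1)%N; lia.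
Qed.

Lemma class_bitsE : (3 <= eras)%N ->
  INR class_bits = INR eras * INR eras * (INR eras * INR eras + 2 * INR n - 7 * INR eras).
Proof.
move=> e3; have [le _] := eras_bounds.
rewrite /class_bits tail_bitsE addn0; move: eras e3 le => b b3 le.
have lb : (3 * b <= n)%N by nia.
have : (((b + b) * (n - b - (b + b)) * b + b * b * (b * b.-1)) + 7 * (b * b * b)
  = b * b * (b * b + 2 * n))%N.
  have [k En] : exists k, n = (3 * b + k)%N by exists (n - 3 * b)%N; lia.
  rewrite En; have -> : (3 * b + k - b - (b + b) = k)%N by lia.
  by case: b b3 {le lb En} => // b _ /=; nia.
move/(congr1 INR); rewrite [LHS]INR_addn !INR_muln [INR (_ + 2 * n)]INR_addn !INR_muln.
have -> : INR 7 = 7 by rewrite /=; lra.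
have -> : INR 2 = 2 by rewrite /=; lra.
by lra.
Qed.
End Sizes.

Section LowerEstimates.
Variables (n b lam E L1 : R).
Hypotheses (b_ge : 1000 <= b) (lam_ge : 100 <= lam) (lam_le : lam <= b).
Hypotheses (n_ge : 4 * (b * b) <= n) (n_le : n <= 4 * ((b + 1) * (b + 1))).
Hypothesis E_def : E = b * b * (b * b + 2 * n - 7 * b).
Hypotheses (L1_ge0 : 0 <= L1) (L1_ge : E <= L1 * (2 * lam + 9)).

Let X := (b * b + b) * (b * b + b + 2 * n).

(** [X] bounds [M (M + 2 n)] for all [M <= b ^ 2 + b]; the number of bits loses at most the fraction
    [6 / b] of it. *)
Lemma class_bits_ratio : (b - 6) * X <= b * E.
Proof.
have bn : 4 * (b * b) * (b * b) <= n * (b * b) by apply: Rmult_le_compat_r; nra.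
have b3 : b * (b * b) <= b * b * (b * b) by nra.
have n0 : 0 <= n * b by nra.
have b2 : 0 <= b * b by nra.
have b30 : 0 <= b * (b * b) by nra.
rewrite /X E_def.
have -> : b * (b * b * (b * b + 2 * n - 7 * b))
  = b * ((b * b + b) * (b * b + b + 2 * n))
    - (9 * (b * b * (b * b)) + b * (b * b) + 2 * (n * (b * b))) by ring.
have -> : (b - 6) * ((b * b + b) * (b * b + b + 2 * n)) =
  b * ((b * b + b) * (b * b + b + 2 * n))
  - 6 * (b * b * (b * b) + 2 * (b * (b * b)) + b * b + 2 * (n * (b * b)) + 2 * (n * b)) by ring.
by lra.
Qed.

Lemma class_bits_ge : 2 / 5 * (n * n) <= E.
Proof.
clear lam_ge lam_le L1_ge0 L1_ge.
have bn : 9 / 40 * n <= b * b by nra.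
have n0 : 0 <= n by nra.
have h1 : 7 * b <= n / 10 by nra.
rewrite E_def.
have := Rmult_le_compat (9 / 40 * n) (b * b) (19 / 10 * n) (b * b + 2 * n - 7 * b)
  ltac:(lra) ltac:(nra) bn ltac:(nra).
by nra.
Qed.

Lemma hard_size_gt_n : n + 2 < L1.
Proof.
have E5 := class_bits_ge.
have n0 : 0 < n by nra.
have bn : 4000 * b <= n by nra.
have l3 : 2 * lam + 9 <= 3 * b by lra.
have H : 2 / 5 * (n * n) <= L1 * (3 * b).
  apply: Rle_trans E5 _; apply: Rle_trans L1_ge _.
  by apply: Rmult_le_compat_l.
apply: (Rmult_lt_reg_r (3 * b)); first lra.
apply: Rlt_le_trans H.
have : (n + 2) * (3 * b) <= (n + 2) * (3 * (n / 4000)) by apply: Rmult_le_compat_l; lra.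
by nra.
Qed.

(** Serves to exclude few conjunctions: three times [65 / 1024] is less than [2 / 5]. *)
Lemma hard_size_gt_small K lK : 0 <= K -> K <= n / 32 -> lam - 6 <= lK ->
  K * (K + 2 * n) / lK < L1.
Proof.
move=> K0 Kn lKge.
have E5 := class_bits_ge.
have n0 : 0 < n by nra.
have nn : 0 < n * n by nra.
have KK : K * (K + 2 * n) <= 65 / 1024 * (n * n).
  have := Rmult_le_compat K (n / 32) (K + 2 * n) (65 / 32 * n) K0 ltac:(lra) Kn ltac:(lra).
  by lra.
have lL : 2 * lam + 9 <= 3 * lK by lra.
have H : 2 / 5 * (n * n) <= L1 * (3 * lK).
  apply: Rle_trans E5 _; apply: Rle_trans L1_ge _.
  by apply: Rmult_le_compat_l.
apply: (Rmult_lt_reg_r lK); first lra.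
have -> : K * (K + 2 * n) / lK * lK = K * (K + 2 * n) by field; lra.
by lra.
Qed.

(** For [lM = log2 M], the condition [lam - 6 <= lM] reflects [M >= n / 64]. The loss [9 / lam] pays
    for this shift, the overhead in [2 lam + 9] and the fraction lost in [class_bits_ratio]. *)
Lemma hard_size_ge M lM : 0 <= M -> M <= b * b + b -> lam - 6 <= lM ->
  (/ 2 - 9 / lam) * (M * (M + 2 * n)) / lM <= L1.
Proof.
move=> M0 Mb lMge.
have n0 : 0 < n by nra.
have X0 : 0 <= X by rewrite /X; apply: Rmult_le_pos; nra.
have MX : M * (M + 2 * n) <= X by rewrite /X; apply: Rmult_le_compat; nra.
have l9 : 9 / lam <= / 2.
  apply: (Rmult_le_reg_r lam); first lra.
  by have -> : 9 / lam * lam = 9; [field; lra|lra].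
have W0 : 0 <= M * (M + 2 * n) by apply: Rmult_le_pos; nra.
apply: (Rmult_le_reg_r lM); first lra.
have -> : (/ 2 - 9 / lam) * (M * (M + 2 * n)) / lM * lM
  = (/ 2 - 9 / lam) * (M * (M + 2 * n)) by field; lra.
apply: Rle_trans (_ : (/ 2 - 9 / lam) * X <= _).
  by apply: Rmult_le_compat_l; lra.
apply: Rle_trans (_ : L1 * (lam - 6) <= _); last by apply: Rmult_le_compat_l.
(* [(1/2 - 9/lam) (2 lam + 9) <= lam - 27/2] and [(lam - 27/2) b <= (lam - 6)(b - 6)] *)
apply: (Rmult_le_reg_r (2 * lam + 9)); first lra.
apply: Rle_trans (_ : E * (lam - 6) <= _); last first.
  have := Rmult_le_compat_r (lam - 6) _ _ ltac:(lra) L1_ge; lra.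
have s1 : (/ 2 - 9 / lam) * (2 * lam + 9) <= lam - 27 / 2.
  have -> : (/ 2 - 9 / lam) * (2 * lam + 9) = lam + 9 / 2 - 18 - 81 / lam by field; lra.
  have : 0 <= 81 / lam by apply: Rle_mult_inv_pos; lra.
  by lra.
have s2 : (lam - 27 / 2) * b <= (lam - 6) * (b - 6) by nra.
apply: (Rmult_le_reg_r b); first lra.
have s3 := class_bits_ratio.
have t1 := Rmult_le_compat_r X _ _ X0 s1.
have t2 := Rmult_le_compat_r X _ _ X0 s2.
have t3 := Rmult_le_compat_l (lam - 6) _ _ ltac:(lra) s3.
have t4 := Rmult_le_compat_r b _ _ ltac:(lra) t1.
by lra.
Qed.
End LowerEstimates.

Lemma leq_exp2_eras b : (10 <= b -> 4 * (b.+1 * b.+1) <= 2 ^ b)%N.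
Proof.
elim: b => // b IH lb; rewrite expnS.
have [lb'|] := leqP 10 b; first by move: (IH lb') => /=; nia.
by move=> lb'; have -> : b = 9%N by lia.
Qed.

(** * Hardness for all large [n], and the final sequence *)

Definition eventually (P : nat -> Prop) := exists N, forall n, (N <= n)%N -> P n.

Lemma eventually_and P Q : eventually P -> eventually Q ->
  eventually (fun n => P n /\ Q n).
Proof.
move=> [N HN] [N' HN']; exists (maxn N N') => n; rewrite geq_max => /andP [l1 l2].
by split; [exact: HN|exact: HN'].
Qed.

Lemma INR_archimed x : exists k, x <= INR k.
Proof.
exists (Z.to_nat (up x)).
have [x0|x0] := Rle_dec x 0.
  exact: Rle_trans x0 (pos_INR _).
have [u1 _] := archimed x.
have up0 : Z.le Z0 (up x) by apply: le_IZR; lra.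
by rewrite INR_IZR_INZ Z2Nat.id //; lra.
Qed.

Lemma eventually_eras x : eventually (fun n => x <= INR (eras n)).
Proof.
have [k Hk] := INR_archimed x; exists (4 * (k.+1 * k.+1))%N => n ln.
apply: Rle_trans Hk _; apply: INR_leq; have [_ l2] := eras_bounds n.
rewrite leqNgt; apply/negP=> lk.
have : ((eras n).+1 * (eras n).+1 <= k.+1 * k.+1)%N by rewrite leq_mul // ltnS ltnW.
by lia.
Qed.

Lemma eventually_log2 x : eventually (fun n => x <= log2 (INR n)).
Proof.
have [k Hk] := INR_archimed x; exists (2 ^ k)%N => n ln.
apply: Rle_trans Hk _; rewrite -log2_pow; apply: log2_le; first by apply: pow_lt; lra.
by rewrite -INR_expn2; apply: INR_leq.
Qed.

Lemma log2_div64 x : 0 < x -> log2 (x / 64) = log2 x - 6.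
Proof.
move=> x0; have -> : 6 = log2 64.
  have -> : 64 = 2 ^ 6 by lra.
  by rewrite log2_pow /=; lra.
have E : ln (x / 64) = ln x - ln 64 by rewrite /Rdiv ln_mult ?ln_Rinv; lra.
rewrite /log2 E.
by field; have := ln2_gt0; lra.
Qed.

Lemma eventually_hard : eventually (fun n =>
  exists (f : boolfun n) (M : nat), [/\ mult_complexity f M, INR n / 64 <= INR M &
    forall C, implements C f ->
      (/ 2 - 9 / log2 (INR n)) * (INR M * (INR M + 2 * INR n)) / log2 (INR M)
      <= INR (circ_size C)]).
Proof.
have cv : Un_cv (eps_of (/ 64)) 0 by apply: eps_of_cv; lra.
(* Beyond [N0] the factor [/ 2 + eps] of the upper bound is below 1. *)
have [N0 HN0] := cv (/ 2) ltac:(lra).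
have evN : eventually (fun n => (64 * N0 + 64 <= n)%N) by exists (64 * N0 + 64)%N.
have [N HN] := eventually_and (eventually_and (eventually_eras 1000) (eventually_log2 100)) evN.
exists N => n /HN [[b_ge lam_ge] nN0].
set b := eras n in b_ge; set lam := log2 (INR n) in lam_ge *.
have b10 : (10 <= b)%N by apply: leq_INR; have -> : INR 10 = 10; [rewrite /=; lra|lra].
have [nb1 nb2] := eras_bounds n; rewrite -/b in nb1 nb2.
have n_gt0 : (0 < n)%N by lia.
have E4 : INR 4 = 4 by rewrite /=; lra.
have n_ge : 4 * (INR b * INR b) <= INR n.
  by move/INR_leq: nb1; rewrite !INR_muln E4.
have n_le : INR n <= 4 * ((INR b + 1) * (INR b + 1)).
  by move/ltnW/INR_leq: nb2; rewrite !INR_muln E4 S_INR.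
have lam_le : lam <= INR b.
  rewrite -log2_pow; apply: log2_le; first by apply: lt_0_INR; apply/ltP.
  rewrite -INR_expn2; apply: INR_leq; apply: leq_trans (ltnW nb2) _.
  exact: leq_exp2_eras.
have ED := @class_bitsE n (leq_trans (isT : 3 <= 10)%N b10); rewrite -/b in ED.
have E5 := class_bits_ge b_ge n_ge n_le ED.
have n0 : 0 < INR n by apply: lt_0_INR; apply/ltP.
have bits_gt0 : (0 < class_bits n)%N.
  by apply: leq_INR; have : 0 < INR n * INR n by [nra]; move: E5 => /=; nra.
set l := (trunc_log 2 n).+1; pose hs := hard_size n.
have [lt1 _] := log2_trunc n_gt0; rewrite -/lam in lt1.
have L1_ge : INR (class_bits n) <= INR hs.+1 * (2 * lam + 9).
  have /INR_leq : (class_bits n <= hs.+1 * (2 * l + 7))%N.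
    by rewrite -(prednK bits_gt0) ltn_ceil.
  rewrite INR_muln INR_addn INR_muln.
  have -> : INR 2 = 2 by rewrite /=; lra.
  have -> : INR 7 = 7 by rewrite /=; lra.
  move/Rle_trans; apply; apply: Rmult_le_compat_l; first exact: pos_INR.
  by rewrite /l S_INR; lra.
have L1_ge0 := pos_INR hs.+1.
have hsn := hard_size_gt_n b_ge lam_ge lam_le n_ge n_le ED L1_ge0 L1_ge.
(* Of the [n] variables, [b] serve as selectors, for [b] eras of [b] products. *)
have := @hard_function (n - b) b b hs l.
rewrite subnK; last by nia.
have c1 : ((b + b) * b <= n - b)%N by nia.
have c2 : (n < hs)%N by apply: leq_INR; move: hsn; rewrite !S_INR; lra.
have c3 : (hs <= 2 ^ (2 * l))%N.
  apply: (@leq_trans (n * n)%N).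
    apply: leq_trans (leq_div _ _) _; apply: leq_trans (leq_pred _) _.
    apply: leq_INR; rewrite ED INR_muln.
    have b0 := pos_INR b.
    apply: Rle_trans (_ : INR n / 4 * (4 * INR n) <= _); last lra.
    by apply: Rmult_le_compat; nra.
  rewrite mul2n -addnn expnD; have := ltnW (trunc_log_ltn n (isT : 1 < 2)%N).
  by rewrite -/l => ln; rewrite leq_mul.
have c4 : (hs * (2 * l + 7) < class_bits n)%N.
  by rewrite -[X in (_ < X)%N](prednK bits_gt0) ltnS leq_trunc_div.
move=> /(_ c1 c2 c3 c4) [f [[C0 [impC0 mC0]] Hf]].
have [M HM] := mult_complexity_exists impC0; exists f, M.
have [[C1 [impC1 mC1]] least] := HM.
have E64 : INR 64 = 64 by rewrite INR_IZR_INZ.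
have Mge : INR n / 64 <= INR M.
  apply: Rnot_lt_le => Mlt.
  (* If [M < n / 64], the count is raised to [K], between [n / 64] and [n / 32], so that the upper
     bound applies with [c = / 64]. It gives a circuit too small for the hardness of [f]. *)
  pose K := (n %/ 64).+1.
  have KM : (M <= K)%N.
    apply: leq_INR; have := ltn_ceil n (isT : 0 < 64)%N; rewrite -/K => /ltnW/INR_leq.
    by rewrite INR_muln E64; lra.
  have K1 : (1 < K)%N by rewrite ltnS divn_gt0 //; lia.
  have Kn : INR K <= INR n / 32.
    have /INR_leq : (32 * K <= n)%N by have := leq_trunc_div n 64; rewrite /K; lia.
    rewrite INR_muln; have -> : INR 32 = 32 by rewrite INR_IZR_INZ.
    by lra.
  have nK : INR n <= 64 * INR K.
    by have := INR_leq (ltnW (ltn_ceil n (isT : 0 < 64)%N)); rewrite INR_muln E64 -/K; lra.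
  have NK : (K >= N0)%coq_nat by apply/leP; rewrite /K; have := ltn_ceil n (isT : 0 < 64)%N; lia.
  have := HN0 K NK; rewrite /R_dist Rminus_0_r => /Rabs_def2 [epsK _].
  have [|C' [impC' sC']] := @upper_part (/ 64) ltac:(lra) n f K K1 ltac:(lra).
    by exists C1; rewrite mC1.
  have := Hf C' impC'; rewrite -/(circ_size C') => /INR_leq hsC.
  have K0 := pos_INR K.
  have lK : lam - 6 <= log2 (INR K).
    by rewrite /lam -log2_div64 //; apply: log2_le; lra.
  have lK0 : 0 < log2 (INR K) by lra.
  have := hard_size_gt_small b_ge lam_ge n_ge n_le ED L1_ge0 L1_ge K0 Kn lK.
  suff : INR (circ_size C') <= INR K * (INR K + 2 * INR n) / log2 (INR K) by lra.
  apply: Rle_trans sC' _; rewrite /Rdiv.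
  apply: Rmult_le_compat_r; first by apply/Rlt_le/Rinv_0_lt_compat.
  rewrite -[X in _ <= X]Rmult_1_l; apply: Rmult_le_compat_r; last lra.
  by apply: Rmult_le_pos; lra.
split=> // C impC.
have /INR_leq hsC := Hf C impC; apply: Rle_trans hsC.
apply: (hard_size_ge b_ge lam_ge lam_le n_ge n_le ED L1_ge0 L1_ge); first exact: pos_INR.
  rewrite -INR_muln -INR_addn; apply: INR_leq.
  exact: leq_trans (least C0 impC0) mC0.
by rewrite /lam -log2_div64 //; apply: log2_le; lra.
Qed.

Lemma delta_cv N : Un_cv (fun n => if (N <= n)%N then 9 / log2 (INR n) else / 2) 0.
Proof.
move=> e e0; have [N' HN'] := eventually_log2 (10 / e).
exists (maxn N N') => n /leP; rewrite geq_max => /andP [-> /HN' ln].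
have e10 : 0 < 10 / e by apply: Rdiv_lt_0_compat; lra.
rewrite /R_dist Rminus_0_r Rabs_right; last by apply/Rle_ge/Rle_mult_inv_pos; lra.
apply: (Rmult_lt_reg_r (log2 (INR n))); first lra.
have -> : 9 / log2 (INR n) * log2 (INR n) = 9 by field; lra.
have := Rmult_le_compat_l e _ _ (Rlt_le _ _ e0) ln.
by have -> : e * (10 / e) = 10; [field; lra|lra].
Qed.

Lemma lower_part :
  exists (f : forall n : nat, boolfun n) (Mn : nat -> nat) (delta : nat -> R),
    (forall n, mult_complexity (f n) (Mn n)) /\
    (exists d : R, 0 < d /\ exists N : nat,
       forall n, (N <= n)%N -> d * INR n <= INR (Mn n)) /\
    Un_cv delta 0 /\
    forall (n : nat) (C : circuit), implements C (f n) ->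
      (/ 2 - delta n) * (INR (Mn n) * (INR (Mn n) + 2 * INR n)) / log2 (INR (Mn n))
      <= INR (circ_size C).
Proof.
have [N HN] := eventually_hard.
(* For [n < N] the value [/ 2] makes the bound trivial, so a constant function will do. *)
pose delta n := if (N <= n)%N then 9 / log2 (INR n) else / 2.
have H n : exists fM : boolfun n * nat, [/\ mult_complexity fM.1 fM.2,
    (N <= n)%N -> / 64 * INR n <= INR fM.2 &
    forall C, implements C fM.1 ->
      (/ 2 - delta n) * (INR fM.2 * (INR fM.2 + 2 * INR n)) / log2 (INR fM.2)
      <= INR (circ_size C)].
  case ln: (N <= n)%N.
    have [f [M [HM Mn HC]]] := HN n ln; exists (f, M); split=> //=; first by move=> _; lra.
    by move=> C /HC; rewrite /delta ln.
  have [|M HM] := @mult_complexity_exists n (fun=> true) [::].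
    by split=> //; exists 0%N.
  exists (fun=> true, M); split=> // C _.
  rewrite /delta ln Rminus_diag Rmult_0_l /Rdiv Rmult_0_l; exact: pos_INR.
pose g n := constructive_indefinite_description _ (H n).
exists (fun n => (sval (g n)).1), (fun n => (sval (g n)).2), delta; split; [|split; [|split]].
- by move=> n; have [] := svalP (g n).
- exists (/ 64); split; first lra.
  by exists N => n; have [] := svalP (g n).
- exact: delta_cv.
- by move=> n; have [] := svalP (g n).
Qed.

Local Close Scope R_scope.
Delimit Scope R_scope with R.

Theorem theorem1 :
  (* (i) upper bound *)
  (forall c : R, (0 < c)%R ->
     exists eps : nat -> R, Un_cv eps 0 /\
       forall (n : nat) (f : boolfun n) (M : nat),
         (1 < M)%N ->
         (c * INR n <= INR M)%R ->
         (exists C, implements C f /\ circ_mult C = M) ->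
         exists C', implements C' f /\
           (INR (circ_size C') <=
              (/ 2 + eps M) * (INR M * (INR M + 2 * INR n)) / log2 (INR M))%R)
  /\
  (* (ii) asymptotic optimality *)
  (exists (f : forall n : nat, boolfun n) (Mn : nat -> nat) (delta : nat -> R),
     (forall n, mult_complexity (f n) (Mn n)) /\
     (exists d : R, (0 < d)%R /\ exists N : nat,
        forall n, (N <= n)%N -> (d * INR n <= INR (Mn n))%R) /\
     Un_cv delta 0 /\
     forall (n : nat) (C : circuit), implements C (f n) ->
       ((/ 2 - delta n) * (INR (Mn n) * (INR (Mn n) + 2 * INR n))
          / log2 (INR (Mn n)) <= INR (circ_size C))%R).
Proof.
split; last exact: lower_part.
move=> c c0; exists (eps_of c); split; first exact: eps_of_cv.
move=> n f M M1 cn [C [impC mC]]; apply: upper_part => //.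
by exists C; rewrite mC.
Qed.
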